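(* Let $a\ge 1$ and $\delta\ge 0$. There is a constant $M=M(a,\delta)$, depending only on $a$ and $\delta$, such that if $(X,d)$ is a minimally nice $a$-John space which is Gromov $\delta$-hyperbolic (that is, $(X,k)$ is $\delta$-hyperbolic, where $k$ is the quasihyperbolic metric of $X$), then every quasihyperbolic geodesic in $X$ is a double $M$-cone arc. In particular, a John space with a Gromov hyperbolic quasihyperbolization is quasihyperbolic John.
   Context: A metric space $(X,d)$ is minimally nice if it is locally compact, incomplete and rectifiably connected (every pair of points can be joined by a curve of finite length) and the identity map $(X,d)\to(X,l)$ is continuous, where $l(x,y)$ is the infimum of the $d$-lengths $\ell(\gamma)$ of rectifiable curves $\gamma$ in $X$ joining $x$ and $y$. The metric boundary is $\partial X=\bar X\setminus X$, where $\bar X$ is the metric completion, and $d(z)=\mathrm{dist}(z,\partial X)$ for $z\in X$. The quasihyperbolic metric is $k(x,y)=\inf_\gamma\int_\gamma \frac{ds}{d(z)}$, the infimum over all rectifiable curves $\gamma$ in $X$ with endpoints $x,y$, with $ds$ the arc-length element with respect to $d$; the space $(X,k)$ is complete, proper and geodesic, and a quasihyperbolic geodesic is a geodesic of $(X,k)$. For $a\ge1$, an arc $\alpha$ with endpoints $x,y$ is a double $a$-cone arc if $\min\{\ell(\alpha[x,z]),\ell(\alpha[z,y])\}\le a\,d(z)$ for all $z\in\alpha$, where $\alpha[x,z]$ and $\alpha[z,y]$ are the subarcs of $\alpha$ between the indicated points and $\ell$ is $d$-length. A minimally nice space $X$ is $a$-John if every pair of points in $X$ can be joined by a double $a$-cone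 arc in $X$, and John if it is $a$-John for some $a\ge1$. $X$ is quasihyperbolic $a$-John if every quasihyperbolic geodesic in $X$ is a double $a$-cone arc, and quasihyperbolic John if it is quasihyperbolic $a$-John for some $a\ge1$. A geodesic metric space is $\delta$-hyperbolic if for every triple of geodesic arcs $[x,y],[y,z],[z,x]$ every point of $[x,y]$ is within distance $\delta$ of $[y,z]\cup[z,x]$. $X$ is Gromov $\delta$-hyperbolic if $(X,k)$ is $\delta$-hyperbolic; $X$ has a Gromov hyperbolic quasihyperbolization if this holds for some $\delta\ge0$. *)

(* Defs.v *)
From HB Require Import structures.
From mathcomp Require Import all_boot all_order all_algebra.
From mathcomp Require Import all_classical all_reals all_analysis.

Set Implicit Arguments.
Unset Strict Implicit.
Unset Printing Implicit Defensive.

Import Order.TTheory GRing.Theory Num.Theory.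
Import numFieldNormedType.Exports.

Local Open Scope classical_set_scope.
Local Open Scope ring_scope.

Section curves.
Context {R : realType} {X : metricType R}.
Implicit Types (g : R -> X) (a b s t : R) (x y : X).

(* Curves are parametrized by compact intervals [a, b] with a <= b.  The
   degenerate case a = b is allowed, so that constant curves count as arcs and
   geodesics from a point to itself.  Values of g outside [a, b] are junk. *)
Definition is_curve g a b := a <= b /\ {within `[a, b], continuous g}.

Definition curve_length g a b : \bar R :=
  ereal_sup [set (\sum_(0 <= i < size s)
                    mdist (g (nth b (a :: s) i)) (g (nth b s i)))%:E
            | s in [set s | itv_partition a b s]].

Definition rectifiable g a b := is_curve g a b /\ (curve_length g a b < +oo)%E.

Definition joins g a b x y := g a = x /\ g b = y.

(* The arc length parametrization of g, on [0, length of g]; the value does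
   not depend on the chosen t since g is constant on every interval where its length
   function is. *)
Definition arclength_param g a b s : X :=
  g (xget a [set t | t \in `[a, b] /\ curve_length g a t = s%:E]).

Definition line_integral (f : X -> R) g a b : \bar R :=
  (\int[lebesgue_measure]_(s in `[0%R, fine (curve_length g a b)])
     (f (arclength_param g a b s))%:E)%E.

Definition inner_dist x y : \bar R :=
  ereal_inf [set r | exists g a b,
    [/\ rectifiable g a b, joins g a b x y & r = curve_length g a b]].

Definition is_arc g a b := is_curve g a b /\ {in `[a, b] &, injective g}.

(* g is an isometric embedding of [a, b] for the distance function rho, which
   need not be the distance of X. *)
Definition is_geodesic (rho : X -> X -> R) g a b :=
  a <= b /\ {in `[a, b] &, forall s t, rho (g s) (g t) = `|s - t|}.

Definition geodesic_arc (rho : X -> X -> R) x y (A : set X) :=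
  exists g a b,
    [/\ is_geodesic rho g a b, joins g a b x y & A = g @` `[a, b]].

Definition geodesic_space (rho : X -> X -> R) :=
  forall x y, exists A, geodesic_arc rho x y A.

Definition thin_triangles (rho : X -> X -> R) (delta : R) :=
  forall x y z A B C,
    geodesic_arc rho x y A -> geodesic_arc rho y z B ->
    geodesic_arc rho z x C ->
    forall p, A p -> exists2 q, (B `|` C) q & rho p q <= delta.

Definition hyperbolic (rho : X -> X -> R) (delta : R) :=
  geodesic_space rho /\ thin_triangles rho delta.

End curves.

(* The library's completeType asks for a base point; this is its axiom. *)
Definition complete_space {R : realType} (X : metricType R) :=
  forall F : set_system X, ProperFilter F -> cauchy F -> exists x : X, F --> x.

Definition minimally_nice {R : realType} (X : metricType R) :=
  [/\ locally_compact [set: X],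
      ~ complete_space X,
      forall x y : X, exists g a b, rectifiable g a b /\ joins g a b x y &
      forall (x : X) (e : R), 0 < e ->
        \forall y \near x, (inner_dist x y < e%:E)%E].

(* The metric completion, which is unique up to a unique isometry over X. *)
Record completion {R : realType} (X : metricType R) := Completion {
  completion_space : metricType R;
  completion_emb : X -> completion_space;
  completion_complete : complete_space completion_space;
  completion_isometry : forall x y,
    mdist (completion_emb x) (completion_emb y) = mdist x y;
  completion_dense : dense (range completion_emb)
}.

Section quasihyperbolic.
Context {R : realType} {X : metricType R} (Xbar : completion X).
Implicit Types (g : R -> X) (x y z : X).

Definition metric_boundary : set (completion_space Xbar) :=
  ~` range (completion_emb Xbar).

Definition dist_boundary z : R :=
  inf [set mdist (completion_emb Xbar z) w | w in metric_boundary].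

(* The infimum is finite when X is minimally nice. *)
Definition qh_dist x y : R :=
  fine (ereal_inf [set r | exists g a b,
    [/\ rectifiable g a b, joins g a b x y &
        r = line_integral (fun z => (dist_boundary z)^-1) g a b]]).

Definition double_cone_arc (c : R) g (a b : R) :=
  is_arc g a b /\
  forall t, t \in `[a, b] ->
    (Order.min (curve_length g a t) (curve_length g t b)
       <= (c * dist_boundary (g t))%:E)%E.

Definition john_with (c : R) :=
  forall x y, exists g a b, double_cone_arc c g a b /\ joins g a b x y.

Definition john := exists2 c : R, 1 <= c & john_with c.

Definition qh_john_with (c : R) :=
  forall g a b, is_geodesic qh_dist g a b -> double_cone_arc c g a b.

Definition qh_john := exists2 c : R, 1 <= c & qh_john_with c.

Definition gromov_hyperbolic_with (delta : R) := hyperbolic qh_dist delta.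

Definition gromov_hyperbolic :=
  exists2 delta : R, 0 <= delta & gromov_hyperbolic_with delta.

End quasihyperbolic.

(* Main.v *)
Require Import Defs.
From mathcomp Require Import all_boot all_order all_algebra.
From mathcomp Require Import all_classical all_reals all_analysis.
From mathcomp Require Import measurable_realfun ring lra zify.

(* Write k for the quasihyperbolic distance and D for the distance to the
   boundary; ln D is Lipschitz for k.  Along either half of a cone arc, D is
   comparable to D(endpoint) + arc length from that endpoint, so points at which
   this sum grows geometrically form a k-quasigeodesic, which by the Morse lemma
   stays near the k-geodesic with the same endpoints.  Applied to the two halves
   of a John arc from x to y and to the resulting thin triangle, this shows that
   every point p of a quasihyperbolic geodesic [x, y] is at bounded k-distance
   from a point of the John arc, hence D(p) >= C^-1 e^(c k(e, p)) D(e) for one of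
   the endpoints e.  Choosing for y a point where D is nearly maximal on the
   geodesic rules out e = y except at bounded distance from y, so D decays
   exponentially in k away from that point, and integrating D bounds the
   length. *)

Set Implicit Arguments.
Unset Strict Implicit.
Unset Printing Implicit Defensive.

Import Order.TTheory GRing.Theory Num.Theory.
Import numFieldNormedType.Exports.

Local Open Scope classical_set_scope.
Local Open Scope ring_scope.

(** * Chains in hyperbolic spaces *)


Section coarse_metric.
Context {R : realType} {X : metricType R}.
Implicit Types (rho : X -> X -> R) (x y z p q : X) (g : R -> X).

(** Since [M] has to be uniform over all spaces, the main estimates concern an abstract distance
    [rho] and an abstract function [D], and their constants are quantified before the space. Only
    one half of the Morse lemma is used, that a geodesic stays near a quasigeodesic, and the
    quasigeodesic may be discrete; this is why John arcs are reduced to finite chains of points. The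
    index of a chain vertex is what carries the exponential: the [i]-th vertex from [e] has [D]
    comparable to [D e * expR (c * i)] and lies within [i] of [e], so a vertex near [p] has an index
    at least the distance from [e] to [p], up to a constant. The original metric is controlled by
    [rho] only locally: [mdist x y <= 2 * rho x y * D x] once [rho x y < 2^-1]. Both the Lipschitz
    property of [ln D] and the final length bound come from adding up such short steps along a
    geodesic, so no line integral along a quasihyperbolic geodesic is ever taken. *)

Definition on_geodesic rho x y p := exists2 A, geodesic_arc rho x y A & A p.

Definition distance_function rho :=
  [/\ forall x, rho x x = 0, forall x y, rho x y = rho y x &
      forall y x z, rho x z <= rho x y + rho y z].

Lemma is_geodesicN rho g a b :
  is_geodesic rho g a b -> is_geodesic rho (g \o -%R) (- b) (- a).
Proof.
move=> [ab gE]; split=> [|s t]; first by rewrite lerN2.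
rewrite !in_itv/= => /andP[bs sa] /andP[bt ta].
rewrite gE ?in_itv/= ?(lerNl b, lerNr a)//.
- by rewrite opprK addrC distrC.
- by apply/andP; split; lra.
- by apply/andP; split; lra.
Qed.

Lemma on_geodesicC rho x y p : on_geodesic rho x y p -> on_geodesic rho y x p.
Proof.
move=> [_ [g [a [b [gG [ga gb] ->]]]] [t /=]].
rewrite in_itv/= => /andP[at_ tb] <-.
exists ((g \o -%R) @` `[- b, - a]).
  exists (g \o -%R), (- b), (- a); split=> //.
    exact: is_geodesicN.
  by rewrite /joins /= !opprK.
by exists (- t); rewrite /= ?opprK// in_itv/= !lerN2 at_ tb.
Qed.

Lemma geodesic_on_geodesic rho g a b r s t : is_geodesic rho g a b ->
  a <= r -> r <= s -> s <= t -> t <= b -> on_geodesic rho (g r) (g t) (g s).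
Proof.
move=> [ab gE] ar rs st tb; exists (g @` `[r, t]); last first.
  by exists s => //=; rewrite in_itv/= rs.
exists g, r, t; split=> //; split=> [|u v]; first exact: le_trans st.
rewrite !in_itv/= => /andP[ru ut] /andP[rv vt].
by rewrite gE// in_itv/=; apply/andP; split; lra.
Qed.

Lemma geodesic_dist rho g a b s t : is_geodesic rho g a b ->
  a <= s -> s <= t -> t <= b -> rho (g s) (g t) = t - s.
Proof.
move=> [ab gE] as_ st tb; rewrite gE ?in_itv/=; last 2 first.
- by apply/andP; split; lra.
- by apply/andP; split; lra.
by rewrite ler0_norm ?opprB// subr_le0.
Qed.

Lemma on_geodesic_dist rho x y p : on_geodesic rho x y p ->
  [/\ rho x p <= rho x y, 0 <= rho x p & rho x y = rho x p + rho p y].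
Proof.
move=> [_ [g [a [b [gG [<- <-] ->]]]] [t /=]].
rewrite in_itv/= => /andP[at_ tb] <-; have ab := gG.1.
rewrite !(geodesic_dist gG)//; split; lra.
Qed.

End coarse_metric.

Section thin_chains.
Context {R : realType} {X : metricType R} (rho : X -> X -> R) (delta : R).
Context (rho_dist : distance_function rho) (rho_hyp : hyperbolic rho delta).

Lemma thin_on_geodesic x y z p : on_geodesic rho x y p ->
  exists2 q, on_geodesic rho x z q \/ on_geodesic rho z y q & rho p q <= delta.
Proof.
move=> [A xyA Ap].
have [[B yzB] [C zxC]] : (exists B, geodesic_arc rho y z B) /\
  exists C, geodesic_arc rho z x C by split; exact: rho_hyp.1.
have [q [Bq|Cq] pq] := rho_hyp.2 _ _ _ _ _ _ xyA yzB zxC _ Ap; exists q => //.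
  by right; apply: on_geodesicC; exists B.
by left; apply: on_geodesicC; exists C.
Qed.

(** Cutting the chain at its middle vertex costs one thin triangle, hence one [delta], and [m]
    halvings reach a single edge. The error is thus logarithmic in the number of edges. *)
Lemma thin_dyadic_chain m (v : nat -> X) p :
  on_geodesic rho (v 0%N) (v (2 ^ m)%N) p ->
  exists i q, [/\ (i < 2 ^ m)%N, on_geodesic rho (v i) (v i.+1) q &
                 rho p q <= delta *+ m].
Proof.
have [xx sym tri] := rho_dist.
elim: m v p => [v p vp|m IH v p /thin_on_geodesic].
  by exists 0%N, p; rewrite mulr0n xx.
move=> /(_ (v (2 ^ m)%N)) [q qv pq].
have [i [q' [im vq' qq']]] : exists i q', [/\ (i < 2 ^ m.+1)%N,
    on_geodesic rho (v i) (v i.+1) q' & rho q q' <= delta *+ m].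
  case: qv => [/IH[i [q' [im vq' qq']]]|qv].
    by exists i, q'; split=> //; rewrite (leq_trans im)// leq_pexp2l.
  have [|i [q' [im vq' qq']]] := IH (fun i => v (2 ^ m + i)%N) q.
    by rewrite addn0 addnn -mul2n -expnS.
  by exists (2 ^ m + i)%N, q'; rewrite -addnS; split=> //; rewrite expnS; lia.
exists i, q'; split=> //; rewrite mulrS.
by apply: le_trans (tri q p q') _; exact: lerD.
Qed.

End thin_chains.

(** Makes the comparison of a logarithmic with a linear bound effective in [chain_stability]. A
    quadratic minorant of [2 ^ m] is enough: beyond the chosen bound, [m ^ 2 <= 2 * 2 ^ m <= 2 *
    (|P| + |Q|) * m < m ^ 2]. *)
Lemma exp2_affine_bounded {R : realType} (P Q : R) :
  exists m0 : nat, forall m : nat, 2 ^+ m <= P * m%:R + Q -> (m <= m0)%N.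
Proof.
have sq m : (m ^ 2 <= 2 * 2 ^ m)%N.
  elim: m => // m IH; have [m2|m2] := leqP m 2.
    by case: m m2 {IH} => [|[|[|]]].
  by rewrite (expnS 2); nia.
exists (Num.bound (2 * (`|P| + `|Q|))) => m Pm; rewrite leqNgt; apply/negP => m0.
have Pm0 : 2 * (`|P| + `|Q|) < m%:R.
  apply: lt_trans (archi_boundP _) _; last by rewrite ltr_nat.
  by rewrite mulr_ge0// addr_ge0.
have m1 : 1 <= m%:R :> R by rewrite ler1n; lia.
have sqm : m%:R ^+ 2 <= 2 * 2 ^+ m :> R by rewrite -!natrX -natrM ler_nat sq.
have := ler_norm P; have := ler_norm Q; have := normr_ge0 Q; nra.
Qed.


Section chain_stability.
Context {R : realType} {X : metricType R} (rho : X -> X -> R) (delta : R).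
Context (rho_dist : distance_function rho) (rho_hyp : hyperbolic rho delta).

(** Vertices close to two successive points of a geodesic may occur in either order along the chain,
    so the walk may go backwards. The sum of the two truncated differences is [|i1 - i2|]. *)
Lemma chain_walk n (w : nat -> X) i1 i2 : (i1 <= n)%N -> (i2 <= n)%N ->
  (forall i, (i < n)%N -> rho (w i) (w i.+1) <= 1) ->
  exists u : nat -> X, [/\ u 0%N = w i1, u ((i1 - i2) + (i2 - i1))%N = w i2,
    forall j, (j < (i1 - i2) + (i2 - i1))%N -> rho (u j) (u j.+1) <= 1 &
    forall j, (j <= (i1 - i2) + (i2 - i1))%N -> exists2 i, (i <= n)%N & u j = w i].
Proof.
have [_ sym _] := rho_dist.
move=> i1n i2n step; have [i12|i12] := leqP i1 i2.
  exists (fun j => w (i1 + j)%N); split=> [|||j jN].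
  - by rewrite addn0.
  - by congr w; lia.
  - by move=> j jN; rewrite addnS; apply: step; lia.
  - by exists (i1 + j)%N => //; lia.
exists (fun j => w (i1 - j)%N); split=> [|||j jN].
- by rewrite subn0.
- by congr w; lia.
- move=> j jN; rewrite sym (_ : (i1 - j)%N = (i1 - j.+1).+1); last lia.
  by apply: step; lia.
- by exists (i1 - j)%N => //; lia.
Qed.

Lemma detour_bound (D : R) N m (u : nat -> X) x y p :
  on_geodesic rho x y p ->
  (forall j, (j < N)%N -> rho (u j) (u j.+1) <= 1) ->
  (forall j, (j <= N)%N -> D <= rho p (u j)) ->
  (forall q, on_geodesic rho x (u 0%N) q -> D <= rho p q) ->
  (forall q, on_geodesic rho (u N) y q -> D <= rho p q) ->
  D <= rho p y -> (N.+2 <= 2 ^ m)%N -> D - 1 <= delta *+ m.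
Proof.
have [xx sym tri] := rho_dist.
move=> xyp step Du Dx Dy Dpy Nm.
(* The detour has [N.+2] edges: one from [x] to [u 0], the [N] steps of [u], and one to [y]. It then
   rests at [y] until the length is a power of 2. Only the steps of [u] lose the 1 in [D - 1], since
   an inner point of such an edge is within 1 of a vertex. *)
pose v j := if j is j'.+1 then if (j' <= N)%N then u j' else y else x.
have vm : v (2 ^ m)%N = y.
  by case: (2 ^ m)%N Nm => //= k; rewrite ltnS ltnNge => /negbTE ->.
have [|i [q [im vq pq]]] := thin_dyadic_chain rho_dist rho_hyp (m := m) (v := v) (p := p).
  by rewrite vm.
apply: le_trans pq; case: i im vq => [|j] im /=.
  by move/Dx; lra.
have [jN|jN|->] := ltngtP j N => vq.
- have [? ? ?] := on_geodesic_dist vq; have := step _ jN; have := Du _ (ltnW jN).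
  have := tri q p (u j); rewrite (sym q); lra.
- have [] := on_geodesic_dist vq; rewrite xx => ? ? ?.
  by have := tri q p y; rewrite (sym q); lra.
- by have := Dy _ vq; lra.
Qed.

End chain_stability.

Lemma exp2_up_log n : (1 < n)%N -> (2 ^ up_log 2 n <= 2 * n)%N.
Proof.
move=> n1; have m0 : (0 < up_log 2 n)%N by rewrite up_log_gt0.
have /andP[+ _] := up_log_bounds (isT : 1 < 2)%N n1.
by rewrite -{2}(prednK m0) expnS => /ltnW; rewrite leq_pmul2l.
Qed.

(** The half of the Morse lemma that is needed: a point of the geodesic far from the chain forces a
    detour whose length is linear in the distance, while thin triangles allow a distance only
    logarithmic in that length. *)
Lemma chain_stability {R : realType} (delta c C : R) : 0 <= delta -> 0 < c ->
  exists2 H, 0 <= H & forall (X : metricType R) (rho : X -> X -> R),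
    distance_function rho -> hyperbolic rho delta ->
    forall n (w : nat -> X),
    (forall i, (i < n)%N -> rho (w i) (w i.+1) <= 1) ->
    (forall i j, (i <= j)%N -> (j <= n)%N ->
       c * (j - i)%:R <= rho (w i) (w j) + C) ->
    forall p, on_geodesic rho (w 0%N) (w n) p ->
    exists2 i, (i <= n)%N & rho p (w i) <= H.
Proof.
move=> delta0 c0.
(* Below, [L <= delta *+ m + 3] and [c * N%:R <= 6 * L + C], while [2 ^+ m <= 2 * (N%:R + 2)].
   Eliminating [L] and [N] gives an affine bound on [2 ^+ m] with these coefficients. *)
have [m0 m0P] := exp2_affine_bounded (12 * delta / c)
  (2 * ((18 + `|C|) / c + 4)).
(* Of the 2, one unit pays for choosing a nearly farthest point instead of a farthest one, the other
   for the length of a chain edge. *)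
exists (delta *+ m0 + 2); first by rewrite addr_ge0// mulrn_wge0.
move=> X rho rho_dist rho_hyp n w step quasi p [_ [g [s0 [s1 [gG [g0 g1] ->]]]]].
have [xx sym tri] := rho_dist.
move=> [t /=]; rewrite in_itv/= => /andP[s0t ts1] <-{p}.
apply: contrapT => far.
(* The supremum of [E] is the largest distance from a point of the geodesic to the chain. It is
   finite because the geodesic starts at a vertex, and it is only approached, up to 1. *)
pose E := [set D | exists2 t, s0 <= t <= s1 &
  forall i, (i <= n)%N -> D <= rho (g t) (w i)].
have supE : has_sup E.
  split.
    exists (delta *+ m0 + 2), t; rewrite ?s0t// => i iN.
    by rewrite leNgt; apply/negP => /ltW lt; apply: far; exists i.
  exists (s1 - s0) => D [r /andP[s0r rs1] /(_ 0%N (leq0n _))].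
  by rewrite -g0 sym (geodesic_dist gG) => //; lra.
have HE : delta *+ m0 + 2 <= sup E.
  apply: ub_le_sup; first exact: supE.2.
  exists t; rewrite ?s0t// => i iN.
  by rewrite leNgt; apply/negP => /ltW lt; apply: far; exists i.
have [D [{far s0t ts1}r /andP[s0r rs1] Dr] supD] : exists2 D, E D & sup E - 1 < D.
  by apply: sup_adherent => //; exact: ltr01.
(* Since [sup E < D + 1], the value [L] is not in [E], so every point of the geodesic is within [L]
   of some vertex. *)
pose L := D + 2.
(* Leaving the geodesic at distance 2 L on both sides of g r and following the
   chain gives a detour avoiding the D-ball around g r, with a number of steps
   linear in D; thin triangles bound D by its logarithm. *)
have near s : s0 <= s -> s <= s1 -> exists2 i, (i <= n)%N & rho (g s) (w i) <= L.
  move=> s0s ss1; apply: contrapT => no.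
  have : L <= sup E.
    apply: ub_le_sup; first exact: supE.2.
    exists s; rewrite ?s0s// => i iN; rewrite leNgt; apply/negP => /ltW lt.
    by apply: no; exists i.
  by rewrite /L; lra.
have m00 : 0 <= delta *+ m0 by rewrite mulrn_wge0.
have L0 : 0 <= L by rewrite /L; lra.
have [t1 [i1 [s0t1 t1r i1n h1 [h1' r1]]]] : exists t1 i1, [/\ s0 <= t1, t1 <= r,
    (i1 <= n)%N, rho (g t1) (w i1) <= L & (forall q,
    on_geodesic rho (g t1) (w i1) q -> D <= rho (g r) q) /\ r - t1 <= 2 * L].
  (* If the geodesic is too short on this side, its endpoint is used; as this is a vertex of the
     chain, the segment leading to the chain is degenerate. *)
  have [r2|r2] := leP s0 (r - 2 * L); last first.
    exists s0, 0%N; split=> //; first by rewrite g0 xx.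
    split=> [q|]; last by lra.
    move/on_geodesic_dist; rewrite g0 xx => -[? ? ?].
    by have := tri q (g r) (w 0%N); have := Dr 0%N (leq0n _); rewrite (sym q); lra.
  have [//||i iN gi] := near (r - 2 * L); first by lra.
  exists (r - 2 * L), i; split=> //; first by lra.
  split=> [q|]; last by lra.
  move/on_geodesic_dist => -[? ? ?].
  have := tri q (g (r - 2 * L)) (g r); rewrite (geodesic_dist gG) //; last by lra.
  by rewrite (sym q) /L in gi *; lra.
have [t2 [i2 [t2s1 rt2 i2n h2 [h2' r2 Dt2]]]] : exists t2 i2, [/\ t2 <= s1, r <= t2,
    (i2 <= n)%N, rho (g t2) (w i2) <= L & [/\ (forall q,
    on_geodesic rho (w i2) (g t2) q -> D <= rho (g r) q), t2 - r <= 2 * L &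
    D <= rho (g r) (g t2)]].
  have [r2|r2] := leP (r + 2 * L) s1; last first.
    exists s1, n; split=> //; first by rewrite g1 xx.
    split=> [q||]; [|by lra|by rewrite g1; exact: Dr].
    move/on_geodesic_dist; rewrite g1 xx => -[? ? ?].
    by have := tri q (g r) (w n); have := Dr n (leqnn _); rewrite (sym q); lra.
  have [||i iN gi] := near (r + 2 * L); [by lra|by []|].
  exists (r + 2 * L), i; split=> //; first by lra.
  have grr : rho (g r) (g (r + 2 * L)) = 2 * L.
    by rewrite (geodesic_dist gG) //; lra.
  split=> [q||]; [|by lra|by rewrite grr /L; lra].
  move/on_geodesic_dist => -[? ? ?]; rewrite sym in gi.
  by have := tri q (g r) (g (r + 2 * L)); rewrite grr /L in gi *; lra.
have [u [u0 uN ustep uw]] := chain_walk rho_dist i1n i2n step.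
set N := ((i1 - i2) + (i2 - i1))%N in uN ustep uw.
(* The geodesic piece has length at most [4 * L] and each of the two connecting segments at most
   [L]; the lower quasigeodesic bound converts this into a number of steps. *)
have cN : c * N%:R <= 6 * L + C.
  have g12 : rho (g t1) (g t2) <= 4 * L.
    by rewrite (geodesic_dist gG) //; lra.
  have w12 : rho (w i1) (w i2) <= 6 * L.
    have := tri (g t1) (w i1) (w i2); have := tri (g t2) (g t1) (w i2).
    by rewrite (sym (w i1) (g t1)); lra.
  rewrite /N; have [i12|/ltnW i12] := leqP i1 i2.
    rewrite (eqP (i12 : (i1 - i2)%N == 0%N)) add0n.
    by have := quasi _ _ i12 i2n; lra.
  rewrite (eqP (i12 : (i2 - i1)%N == 0%N)) addn0.
  by have := quasi _ _ i12 i1n; rewrite (sym (w i2)); lra.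
pose m := up_log 2 N.+2.
have Dm : D - 1 <= delta *+ m.
  apply: (detour_bound rho_dist rho_hyp (N := N) (u := u) (x := g t1) (y := g t2)
    (p := g r)) => //.
  - exact: geodesic_on_geodesic gG _ _ _ _.
  - by move=> j /uw[i iN ->]; exact: Dr.
  - by rewrite u0.
  - by rewrite uN.
  - exact: up_logP.
have m2 : 2 ^+ m <= 2 * (N%:R + 2) :> R.
  by rewrite -natrX -natrD -natrM ler_nat addn2 exp2_up_log.
have /m0P mm0 : 2 ^+ m <= 12 * delta / c * m%:R + 2 * ((18 + `|C|) / c + 4).
  apply: le_trans m2 _.
  have -> : 12 * delta / c * m%:R + 2 * ((18 + `|C|) / c + 4) =
     2 * ((6 * (delta * m%:R + 3) + `|C|) / c + 4).
    by field; rewrite gt_eqF.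
  have : N%:R <= (6 * (delta * m%:R + 3) + `|C|) / c; last by lra.
  rewrite ler_pdivlMr// mulrC mulr_natr.
  by have := ler_norm C; rewrite /L in cN; lra.
have : delta *+ m <= delta *+ m0 by rewrite -!(mulr_natr delta) ler_wpM2l// ler_nat.
by move: HE supD Dm; lra.
Qed.

(** * Cone chains and the decay of the boundary distance along geodesics *)


Section cone_chains.
Context {R : realType} {X : metricType R}.
Implicit Types (rho : X -> X -> R) (D : X -> R) (x y p : X).

(* The points w i lie on half of a cone arc starting at x, the i-th one where
   D x + arc length equals D x * expR (c * i). *)
Definition cone_chain rho D (c K : R) x n (w : nat -> X) :=
  [/\ w 0%N = x, forall i, (i < n)%N -> rho (w i) (w i.+1) <= 1,
      forall i, (i <= n)%N -> D x * expR (c * i%:R) <= K * D (w i) &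
      forall i, (i <= n)%N -> D (w i) <= K * (D x * expR (c * i%:R))].

(** This says that [ln D] is 2-Lipschitz for [rho]. The sharp constant for the quasihyperbolic
    distance is 1; the 2 is inherited from the local comparison [mdist x y <= 2 * rho x y * D x]. *)
Definition exp_lipschitz rho D :=
  forall x y, D y <= expR (2 * rho x y) * D x.

Lemma chain_dist rho (w : nat -> X) n : distance_function rho ->
  (forall i, (i < n)%N -> rho (w i) (w i.+1) <= 1) ->
  forall i, (i <= n)%N -> rho (w 0%N) (w i) <= i%:R.
Proof.
move=> [xx sym tri] step; elim=> [|i IH] i_n; first by rewrite xx.
apply: le_trans (tri (w i) _ _) _; rewrite -natr1.
by apply: lerD; [exact/IH/ltnW|exact: step].
Qed.

(** Between two vertices [ln D] grows by at least [c * (j - i)] up to [2 * ln K], and it is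
    2-Lipschitz; halving gives the bound. *)
Lemma cone_chain_quasi rho D c K x n (w : nat -> X) :
  (forall x, 0 < D x) -> exp_lipschitz rho D -> 0 < K ->
  cone_chain rho D c K x n w -> forall i j, (i <= j)%N -> (j <= n)%N ->
    c / 2 * (j - i)%:R <= rho (w i) (w j) + ln K.
Proof.
move=> D0 DL K0 [w0 step lo hi] i j ij jn.
have KE : K = expR (ln K) by rewrite lnK.
have h1 := lo j jn; have h2 := hi i (leq_trans ij jn); have h3 := DL (w i) (w j).
have : D x * expR (c * j%:R) <=
    D x * expR (ln K + (2 * rho (w i) (w j) + (ln K + c * i%:R))).
  apply: (le_trans h1); rewrite !expRD -KE.
  rewrite [leRHS](_ : _ = K * (expR (2 * rho (w i) (w j)) *
    (K * (D x * expR (c * i%:R))))); last by ring.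
  rewrite ler_pM2l//; apply: le_trans h3 _.
  by rewrite ler_pM2l ?expR_gt0.
by rewrite ler_pM2l// ler_expR natrB//; lra.
Qed.

End cone_chains.

Lemma cone_chain_tracking {R : realType} (delta c K : R) :
  0 <= delta -> 0 < c -> 0 < K ->
  exists2 K', 0 < K' & forall (X : metricType R) (rho : X -> X -> R) (D : X -> R),
    distance_function rho -> hyperbolic rho delta ->
    (forall x, 0 < D x) -> exp_lipschitz rho D ->
    (forall x y, exists n w n' w', [/\ cone_chain rho D c K x n w,
       cone_chain rho D c K y n' w' & w n = w' n']) ->
    forall x y p, on_geodesic rho x y p ->
    exists e i, [/\ e = x \/ e = y, D e * expR (c * i%:R) <= K' * D p &
                   rho e p <= i%:R + K'].
Proof.
move=> delta0 c0 K0.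
have [|H H0 stab] := chain_stability (ln K) delta0 (_ : 0 < c / 2).
  by rewrite divr_gt0.
(* The sum serves both conclusions: [delta + H] bounds the distance from [p] to a chain vertex, and
   the last term is the factor lost in comparing [D] at that vertex with [D p]. *)
exists (delta + H + K * expR (2 * (delta + H))).
  by rewrite ltr_wpDl ?mulr_gt0 ?expR_gt0// addr_ge0.
move=> X rho D rho_dist rho_hyp D0 DL chains x y p xyp.
have [xx sym tri] := rho_dist.
have [n [w [n' [w' [cw cw' wn]]]]] := chains x y.
have near e m v q : cone_chain rho D c K e m v -> on_geodesic rho e (v m) q ->
    rho p q <= delta -> exists i,
    D e * expR (c * i%:R) <= (delta + H + K * expR (2 * (delta + H))) * D p /\
    rho e p <= i%:R + (delta + H + K * expR (2 * (delta + H))).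
  move=> cv eq pq; have [v0 step lo hi] := cv; rewrite -{1}v0 in eq.
  have [i im qv] := stab _ _ rho_dist rho_hyp _ _ step
    (cone_chain_quasi D0 DL K0 cv) _ eq.
  have pv : rho p (v i) <= delta + H.
    by apply: le_trans (tri q _ _) _; exact: lerD.
  have KE0 : 0 < K * expR (2 * (delta + H)) by rewrite mulr_gt0 ?expR_gt0.
  exists i; split; last first.
    have := chain_dist rho_dist step im; have := tri (v i) e p.
    by rewrite v0 (sym (v i) p); lra.
  apply: le_trans (lo i im) _.
  apply: (@le_trans _ _ (K * (expR (2 * (delta + H)) * D p))); last first.
    rewrite mulrA ler_pM2r// lerDr; lra.
  rewrite ler_pM2l//; apply: le_trans (DL p _) _.
  by rewrite ler_pM2r// ler_expR ler_pM2l.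
have [q [xzq|zyq] pq] := thin_on_geodesic rho_hyp (w n) xyp.
  by have [i [h1 h2]] := near _ _ _ _ cw xzq pq; exists x, i; split=> //; left.
move: zyq; rewrite wn => /on_geodesicC zyq.
by have [i [h1 h2]] := near _ _ _ _ cw' zyq pq; exists y, i; split=> //; right.
Qed.

(** Tracking is applied to the subgeodesic from [g s] to [g m]. If the endpoint found is [g s], the
    decay holds directly. If it is [g m], near maximality gives [D (g m) * expR (c * i) <= 2 * K * D
    (g m)], which bounds [i] and hence [m - t]. *)
Lemma geodesic_decay {R : realType} (c K : R) : 0 < c -> 0 < K ->
  exists2 K', 0 < K' & forall (X : metricType R) (rho : X -> X -> R) (D : X -> R),
    (forall x, 0 < D x) -> exp_lipschitz rho D ->
    (forall x y p, on_geodesic rho x y p ->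
      exists e i, [/\ e = x \/ e = y, D e * expR (c * i%:R) <= K * D p &
                   rho e p <= i%:R + K]) ->
    (forall x y, rho x y = rho y x) ->
    forall g a b s t m, is_geodesic rho g a b ->
      a <= s -> s <= t -> t <= m -> m <= b ->
      (forall u, a <= u <= b -> D (g u) <= 2 * D (g m)) ->
      D (g s) * expR (c * (t - s)) <= K' * D (g t).
Proof.
move=> c0 K0.
(* [r] bounds [m - t] when tracking returns [g m]; [K1] absorbs the additive error [K] into the
   exponential; [K2] is the price of moving by [|r| + 1] along the geodesic. The absolute value is
   there because [ln (2 * K)] may be negative. *)
pose r := ln (2 * K) / c + K; pose K1 := K * expR (c * K).
have K10 : 0 < K1 by rewrite mulr_gt0 ?expR_gt0.
pose K2 := expR ((2 + c) * (`|r| + 1)).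
have K20 : 0 < K2 by exact: expR_gt0.
exists ((K1 + 1) * K2); first by rewrite mulr_gt0// addr_gt0.
move=> X rho D D0 DL track sym g a b s t m gG as_ st tm mb max.
have key s' t' : a <= s' -> s' <= t' -> t' <= m ->
    D (g s') * expR (c * (t' - s')) <= K1 * D (g t') \/ m - t' <= r.
  move=> as' st' tm'.
  have [|e [i [[->|->] lo hi]]] := track (g s') (g m) (g t').
    exact: geodesic_on_geodesic gG _ _ _ _.
  - left; rewrite (geodesic_dist gG)// in hi; last lra.
    rewrite /K1 mulrAC; apply: le_trans (_ : D (g s') * expR (c * i%:R) * expR (c * K) <= _).
      by rewrite -mulrA -expRD ler_pM2l// ler_expR -mulrDr ler_pM2l.
    by rewrite ler_pM2r ?expR_gt0.
  - right; rewrite sym (geodesic_dist gG)// in hi; last lra.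
    have : D (g m) * expR (c * i%:R) <= D (g m) * (2 * K).
      apply: le_trans lo _; rewrite [leRHS](_ : _ = K * (2 * D (g m))); last by ring.
      by rewrite ler_pM2l// max//; apply/andP; split; lra.
    rewrite ler_pM2l// -ler_ln ?posrE ?expR_gt0 ?mulr_gt0// expRK => ci.
    have : i%:R <= ln (2 * K) / c by rewrite ler_pdivlMr// mulrC.
    by rewrite /r; lra.
have r0 : 0 <= `|r| by []; have rr := ler_norm r.
have le12 : K1 <= (K1 + 1) * K2.
  rewrite mulrDl mul1r ler_wpDr//; first exact: ltW.
  by rewrite ler_pMr// -expR0 ler_expR mulr_ge0//; lra.
have [h|far] := key s t as_ st tm.
  by apply: le_trans h _; rewrite ler_pM2r.
(* g t is within r of the maximum: replace t by a point just beyond that range. *)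
have [ts|ts] := leP (t - s) (`|r| + 1).
  have := DL (g t) (g s); rewrite sym (geodesic_dist gG)//; last lra.
  move=> h; apply: le_trans (_ : expR (2 * (t - s)) * D (g t) * expR (c * (t - s)) <= _).
    by rewrite ler_pM2r ?expR_gt0.
  rewrite mulrAC ler_pM2r// -expRD.
  apply: le_trans (_ : K2 <= _); last by rewrite ler_pMl// lerDr ltW.
  by rewrite ler_expR -mulrDl ler_pM2l//; lra.
have st' : s <= t - (`|r| + 1) by lra.
have tm' : t - (`|r| + 1) <= m by lra.
have [h|h] := key _ _ as_ st' tm'; last lra.
have := DL (g t) (g (t - (`|r| + 1))).
rewrite sym (geodesic_dist gG)//; [|lra|lra|lra].
rewrite subKr => h2.
have -> : c * (t - s) = c * (t - (`|r| + 1) - s) + c * (`|r| + 1) by ring.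
rewrite expRD mulrA.
apply: le_trans (_ : K1 * D (g (t - (`|r| + 1))) * expR (c * (`|r| + 1)) <= _).
  by rewrite ler_pM2r ?expR_gt0.
apply: le_trans (_ : K1 * (expR (2 * (`|r| + 1)) * D (g t)) * expR (c * (`|r| + 1)) <= _).
  by rewrite ler_pM2r ?expR_gt0// ler_pM2l.
rewrite /K2 (mulrDl 2) expRD
  [leLHS](_ : _ = K1 * (expR (2 * (`|r| + 1)) * expR (c * (`|r| + 1))) * D (g t)); last by ring.
by rewrite ler_pM2r// ler_pM2r ?mulr_gt0 ?expR_gt0// lerDl.
Qed.


(** [G] is subadditive and the increments of [F] telescope, so an estimate at scales below 1/2
    propagates by steps of length 1/4. *)
Lemma local_increment {R : realType} (G : R -> R -> R) (F : R -> R) a b :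
  (forall r s t, G r t <= G r s + G s t) ->
  (forall s t, a <= s -> s <= t -> t <= b -> t - s < 2^-1 ->
     G s t <= F t - F s) ->
  forall s t, a <= s -> s <= t -> t <= b -> G s t <= F t - F s.
Proof.
move=> tri loc s t as_ st tb.
have [n] : exists n : nat, t - s <= n%:R / 4.
  exists (Num.bound (4 * (t - s))); rewrite ler_pdivlMr// mulrC.
  by apply/ltW/archi_boundP; rewrite mulr_ge0// subr_ge0.
elim: n t st tb => [|n IH] t st tb tn.
  by apply: loc => //; move: tn; rewrite mul0r; lra.
have [?|?] := leP (t - s) 4^-1; first by apply: loc => //; lra.
apply: le_trans (tri s (t - 4^-1) t) _.
have : G s (t - 4^-1) <= F (t - 4^-1) - F s.
  by apply: IH; [lra|lra|move: tn; rewrite -natr1; lra].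
have : G (t - 4^-1) t <= F t - F (t - 4^-1) by apply: loc; lra.
by lra.
Qed.

Section local_comparison.
Context {R : realType} {X : metricType R} (rho : X -> X -> R) (D : X -> R).
Context (D0 : forall x, 0 < D x) (D_lip : forall x y, D y <= D x + mdist x y).
Context (rho_loc : forall x y, rho x y < 2^-1 -> mdist x y <= 2 * rho x y * D x).

(** On a short step from [s] to [t] along a geodesic, [D] grows at most by the factor
    [1 + 2 * (t - s)], which is at most [expR (2 * (t - s))]. *)
Lemma local_exp_lipschitz : geodesic_space rho -> exp_lipschitz rho D.
Proof.
move=> geo x y; have [_ [g [a [b [gG [<- <-] _]]]]] := geo x y.
have ab := gG.1; rewrite (geodesic_dist gG)//.
have : ln (D (g b)) - ln (D (g a)) <= 2 * b - 2 * a.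
  apply: (@local_increment _ (fun s t => ln (D (g t)) - ln (D (g s)))
    ( *%R 2) a b) => // [r s t|s t as_ st tb ts]; first lra.
  have gst := geodesic_dist gG as_ st tb.
  suff : ln (D (g t)) <= (2 * t - 2 * s) + ln (D (g s)) by lra.
  rewrite -ler_expR expRD !lnK ?posrE//.
  have := D_lip (g s) (g t); have := rho_loc (x := g s) (y := g t).
  rewrite gst => /(_ ts); have := expR_ge1Dx (2 * t - 2 * s).
  by have := D0 (g s); nra.
move=> h; have : ln (D (g b)) <= 2 * (b - a) + ln (D (g a)) by lra.
by rewrite -ler_expR expRD !lnK ?posrE.
Qed.

(** The speed of a geodesic at [v] is at most about [2 * D (g v)], hence at most
    [2 * K * D (g t) * expR (c * (v - t))] by decay; the bound is the increment of a primitive of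
    this function. The inequality [1 + x <= expR x] replaces integration. *)
Lemma geodesic_increment g a b c K t : 0 < c -> 0 < K -> is_geodesic rho g a b ->
  t <= b -> (forall s, a <= s -> s <= t -> D (g s) * expR (c * (t - s)) <= K * D (g t)) ->
  forall u v, a <= u -> u <= v -> v <= t ->
  mdist (g u) (g v) <= 2 * K / c * D (g t) * expR (c * (v - t)) -
                       2 * K / c * D (g t) * expR (c * (u - t)).
Proof.
move=> c0 K0 gG tb decay u v au uv vt.
apply: (@local_increment _ (fun s t => mdist (g s) (g t))
  (fun v => 2 * K / c * D (g t) * expR (c * (v - t))) a t) => //.
  by move=> r s r'; exact: metric_triangle.
move=> {au uv vt}u {}v au uv vt vu.
have guv : rho (g u) (g v) = v - u.
  by rewrite (geodesic_dist gG)//; exact: le_trans tb.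
have h := rho_loc (x := g u) (y := g v); rewrite guv in h.
apply: le_trans (h vu) _.
have := decay u au (le_trans uv vt).
have -> : c * (t - u) = - (c * (u - t)) by ring.
rewrite expRN ler_pdivrMr ?expR_gt0// => hd.
have -> : c * (v - t) = c * (u - t) + c * (v - u) by ring.
rewrite expRD -mulrBr.
set e := expR (c * (u - t)) in hd *; have e0 : 0 < e by exact: expR_gt0.
have ev : c * (v - u) <= expR (c * (v - u)) - 1.
  by have := expR_ge1Dx (c * (v - u)); lra.
apply: (@le_trans _ _ (2 * (v - u) * (K * D (g t) * e))).
  by rewrite ler_wpM2l// mulr_ge0// subr_ge0.
have -> : 2 * (v - u) * (K * D (g t) * e) =
    2 * K / c * D (g t) * (e * (c * (v - u))) by field; rewrite gt_eqF.
rewrite ler_wpM2l//; last by rewrite -{3}(mulr1 e) -mulrBr ler_pM2l.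
by rewrite ltW// !mulr_gt0// invr_gt0.
Qed.

End local_comparison.

(** * Length and arc length parametrization *)


Section curve_length.
Context {R : realType} {X : metricType R}.
Implicit Types (g h : R -> X) (a b c r s t : R).

Fixpoint polygon_length g a (l : seq R) : R :=
  if l is x :: l' then mdist (g a) (g x) + polygon_length g x l' else 0.

Lemma polygon_length_cat g a l1 l2 :
  polygon_length g a (l1 ++ l2) =
  polygon_length g a l1 + polygon_length g (last a l1) l2.
Proof. by elim: l1 a => [|x l1 IH] a /=; rewrite ?add0r// IH addrA. Qed.

Lemma curve_lengthE g a b : curve_length g a b =
  ereal_sup [set (polygon_length g a l)%:E | l in [set l | itv_partition a b l]].
Proof.
congr ereal_sup; apply: eq_imagel => l _; congr EFin.
elim: l a => [|x l IH] a /=; first by rewrite big_nil.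
by rewrite big_nat_recl//= -IH.
Qed.

Lemma polygon_le_length g a b l : itv_partition a b l ->
  ((polygon_length g a l)%:E <= curve_length g a b)%E.
Proof. by move=> abl; rewrite curve_lengthE; apply: ereal_sup_ubound; exists l. Qed.

Lemma curve_length_le g a b M :
  (forall l, itv_partition a b l -> ((polygon_length g a l)%:E <= M)%E) ->
  (curve_length g a b <= M)%E.
Proof.
by move=> le; rewrite curve_lengthE; apply: ge_ereal_sup => _ [l abl <-]; exact: le.
Qed.

Lemma mdist_le_length g a b : a <= b ->
  ((mdist (g a) (g b))%:E <= curve_length g a b)%E.
Proof.
rewrite le_eqVlt => /predU1P[->|ab].
  by rewrite mdistxx; have := @polygon_le_length g b b [::]; apply.
by have := @polygon_le_length g a b [:: b]; rewrite /= addr0; apply; exact: itv_partition1.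
Qed.

Lemma curve_length_ge0 g a b : a <= b -> (0 <= curve_length g a b)%E.
Proof. by move=> /(mdist_le_length g); apply: le_trans; rewrite lee_fin mdist_ge0. Qed.

Lemma curve_length_nn g a : curve_length g a a = 0%E.
Proof.
apply/eqP; rewrite eq_le curve_length_ge0// andbT.
by apply: curve_length_le => l /itv_partitionxx ->.
Qed.

Lemma itv_partition_split g a b c l : a <= b -> b <= c -> itv_partition a c l ->
  exists l1 l2, [/\ itv_partition a b l1, itv_partition b c l2 &
    polygon_length g a l <= polygon_length g a l1 + polygon_length g b l2].
Proof.
elim: l a => [|x l IH] a ab bc abl.
  have ac := itv_partition_nil abl; have <- : a = b.
    by apply/eqP; rewrite eq_le ab ac.
  by exists [::], [::]; rewrite /= addr0; split=> //; rewrite /itv_partition.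
move: ab abl; rewrite le_eqVlt => /predU1P[->|ab] abl.
  exists [::], (x :: l); rewrite /= add0r; split=> //.
have [/andP[ax xl] lc] := abl; have [xb|bx] := leP x b.
  have [l1 [l2 [p1 p2 le]]] := IH x xb bc (itv_partition_cons abl).
  exists (x :: l1), l2; split=> //; last by rewrite /= -addrA lerD2l.
  by move: p1 => [? ?]; split=> //=; rewrite ax.
exists [:: b], (x :: l); split; first exact: itv_partition1.
  by split=> //=; rewrite bx.
by rewrite /= addr0 addrA lerD2r metric_triangle.
Qed.

Lemma curve_lengthD g a b c : a <= b -> b <= c ->
  curve_length g a c = (curve_length g a b + curve_length g b c)%E.
Proof.
move=> ab bc; apply/eqP; rewrite eq_le; apply/andP; split.
  apply: curve_length_le => l /(itv_partition_split g ab bc)[l1 [l2 [p1 p2 le]]].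
  apply: le_trans (_ : (_ + _)%:E <= _)%E; first by rewrite lee_fin; exact: le.
  by rewrite EFinD leeD// polygon_le_length.
have cat l1 l2 : itv_partition a b l1 -> itv_partition b c l2 ->
    ((polygon_length g a l1)%:E + (polygon_length g b l2)%:E <=
     curve_length g a c)%E.
  move=> p1 p2; have := polygon_le_length g (itv_partition_cat p1 p2).
  by rewrite polygon_length_cat (eqP p1.2).
have cat' l1 : itv_partition a b l1 ->
    ((polygon_length g a l1)%:E + curve_length g b c <= curve_length g a c)%E.
  move=> p1; rewrite addeC -leeBrDr//; apply: curve_length_le => l2 p2.
  by rewrite leeBrDr// addeC cat.
(* Moving the length over [[b, c]] to the other side requires it to be finite. If it is infinite, a
   single partition of [[a, b]] already makes the total length infinite. *)
have [bc_fin|] := boolP (curve_length g b c \is a fin_num).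
  rewrite -leeBrDr//; apply: curve_length_le => l1 p1.
  by rewrite leeBrDr// cat'.
rewrite ge0_fin_numE ?curve_length_ge0// -leNgt leye_eq => /eqP bcy.
have [l1 p1] : exists l1, itv_partition a b l1.
  move: ab; rewrite le_eqVlt => /predU1P[->|/itv_partition1 ?].
    by exists [::]; split.
  by exists [:: b].
by move: (cat' l1 p1); rewrite bcy addey// leye_eq => /eqP ->; rewrite leey.
Qed.

Lemma curve_length_le_increment g (F : R -> R) a b :
  (forall s t, a <= s -> s <= t -> t <= b -> mdist (g s) (g t) <= F t - F s) ->
  (curve_length g a b <= (F b - F a)%:E)%E.
Proof.
move=> gF; apply: curve_length_le => l; rewrite lee_fin.
elim: l a gF => [|x l IH] a gF abl /=.
  by rewrite (itv_partition_nil abl) subrr.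
have xbl := itv_partition_cons abl; have xb := itv_partition_le xbl.
have [/andP[/ltW ax _] _] := abl.
have : polygon_length g x l <= F b - F x.
  by apply: IH => // s t xs; apply: gF; exact: le_trans xs.
by have := gF a x (lexx _) ax xb; lra.
Qed.

Lemma eq_curve_length g h a b : {in `[a, b], g =1 h} ->
  curve_length g a b = curve_length h a b.
Proof.
move=> gh; rewrite !curve_lengthE; congr ereal_sup; apply: eq_imagel => l abl.
congr EFin; elim: l a gh abl => //= x l IH a gh abl.
have xbl := itv_partition_cons abl; have xb := itv_partition_le xbl.
have [/andP[/ltW ax _] _] := abl.
rewrite !gh ?in_itv/= ?lexx ?ax// ?(le_trans ax)//; congr +%R; apply: IH => // t.
rewrite in_itv/= => /andP[xt tb]; apply: gh.
by rewrite in_itv/= tb (le_trans ax).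
Qed.

Lemma curve_length_shift_le g a b c :
  (curve_length (fun t => g (t + c)%R) a b <= curve_length g (a + c)%R (b + c)%R)%E.
Proof.
apply: curve_length_le => l abl.
have -> : polygon_length (fun t => g (t + c)) a l =
    polygon_length g (a + c) [seq t + c | t <- l].
  by elim: l {abl} a => //= x l IH a; rewrite IH.
apply: polygon_le_length; elim: l a abl => [|x l IH] a abl /=.
  by rewrite (itv_partition_nil abl).
have [/andP[ax _] _] := abl; have [? ?] := IH _ (itv_partition_cons abl).
by split=> //=; rewrite ltrD2r ax.
Qed.

Lemma curve_length_shift g a b c :
  curve_length (fun t => g (t + c)) a b = curve_length g (a + c) (b + c).
Proof.
apply/eqP; rewrite eq_le curve_length_shift_le/=.
have := curve_length_shift_le (fun t => g (t + c)) (a + c) (b + c) (- c).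
rewrite !addrK; apply: le_trans; rewrite le_eqVlt; apply/orP; left.
by apply/eqP; apply: eq_curve_length => t _; rewrite subrK.
Qed.

End curve_length.


Section arclength.
Context {R : realType} {X : metricType R}.
Implicit Types (g h : R -> X) (a b c r s t : R).

Lemma within_continuous_mdist (A : set R) g : {within A, continuous g} <->
  forall t, A t -> forall e : R, 0 < e ->
  exists2 d : R, 0 < d & forall u, A u -> `|t - u| < d -> mdist (g t) (g u) < e.
Proof.
rewrite subspace_continuousP; split=> gc t At.
  move=> e e0; have /metricType_numDomainType.cvgrPdist_lt/(_ e e0) := gc t At.
  rewrite near_withinE => /nbhs_ballP[d d0 dP]; exists d => // u Au tu.
  exact: dP.
apply/metricType_numDomainType.cvgrPdist_lt => e e0.
have [d d0 dP] := gc t At e e0.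
by rewrite near_withinE; apply/nbhs_ballP; exists d => // u tu Au; exact: dP.
Qed.

Lemma is_curve_sub g a b s t : is_curve g a b ->
  a <= s -> s <= t -> t <= b -> is_curve g s t.
Proof.
move=> [ab gc] as_ st tb; split=> //; apply: continuous_subspaceW gc => u /=.
by rewrite !in_itv/= => /andP[su ut]; apply/andP; split; lra.
Qed.

Lemma curve_length_le_sub g a b s t : a <= s -> s <= t -> t <= b ->
  (curve_length g s t <= curve_length g a b)%E.
Proof.
move=> as_ st tb; rewrite (curve_lengthD g as_ (le_trans st tb)).
rewrite (curve_lengthD g st tb) addeCA leeDl// adde_ge0// curve_length_ge0//.
Qed.

Lemma rectifiable_sub g a b s t : rectifiable g a b ->
  a <= s -> s <= t -> t <= b -> rectifiable g s t.
Proof.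
move=> [gc gl] as_ st tb; split; first exact: is_curve_sub gc _ _ _.
by apply: le_lt_trans gl; exact: curve_length_le_sub.
Qed.

Definition curve_len g a b : R := fine (curve_length g a b).

Lemma rectifiable_fin g a b : rectifiable g a b ->
  curve_length g a b \is a fin_num.
Proof. by move=> [[ab _] gl]; rewrite ge0_fin_numE// curve_length_ge0. Qed.

Lemma lenE g a b : rectifiable g a b -> curve_length g a b = (curve_len g a b)%:E.
Proof. by move=> /rectifiable_fin gf; rewrite fineK. Qed.

Lemma lenD g a b r s t : rectifiable g a b ->
  a <= r -> r <= s -> s <= t -> t <= b ->
  curve_len g r t = curve_len g r s + curve_len g s t.
Proof.
move=> gR ar rs st tb; apply: EFin_inj; rewrite EFinD -!lenE.
- exact: curve_lengthD.
- by apply: rectifiable_sub gR _ st tb; exact: le_trans rs.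
- by apply: rectifiable_sub gR ar rs _; exact: le_trans tb.
- by apply: rectifiable_sub gR ar _ tb; exact: le_trans st.
Qed.

Lemma mdist_le_len g a b s t : rectifiable g a b ->
  a <= s -> s <= t -> t <= b -> mdist (g s) (g t) <= curve_len g s t.
Proof.
move=> gR as_ st tb; rewrite -lee_fin -lenE; last exact: rectifiable_sub gR _ _ _.
exact: mdist_le_length.
Qed.

Lemma len_ge0 g a b : a <= b -> 0 <= curve_len g a b.
Proof. by move=> ab; apply: fine_ge0; exact: curve_length_ge0. Qed.

Lemma len_nn g a : curve_len g a a = 0.
Proof. by rewrite /curve_len curve_length_nn. Qed.

(** Take for [c] the vertex preceding [b]: past [c] only the last edge is cut by [t], and the
    triangle inequality splits it there. *)
Lemma last_edge g a b l : rectifiable g a b -> a < b -> itv_partition a b l ->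
  exists2 c, a <= c < b & forall t, c <= t -> t < b ->
    polygon_length g a l <= curve_len g a t + mdist (g t) (g b).
Proof.
elim: l a => [|x l IH] a gR ab abl.
  by move: ab; rewrite (itv_partition_nil abl) ltxx.
have xbl := itv_partition_cons abl; have xb := itv_partition_le xbl.
have [/andP[/= ax _] _] := abl.
move: xb; rewrite le_eqVlt => /predU1P[xb|xb].
  exists a; first by rewrite lexx.
  move: xbl; rewrite xb => /itv_partitionxx -> t at_ tb; rewrite /= addr0.
  have := mdist_le_len gR (lexx _) at_ (ltW tb).
  by have := metric_triangle (g a) (g t) (g b); lra.
have gR' : rectifiable g x b by apply: rectifiable_sub gR (ltW ax) (ltW xb) _.
have [c /andP[xc cb] cP] := IH x gR' xb xbl; exists c.
  by rewrite cb (le_trans (ltW ax)).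
move=> t ct tb; have := cP t ct tb; have xt := le_trans xc ct.
rewrite (lenD gR (lexx _) (ltW ax) xt (ltW tb)) /=.
have := mdist_le_len gR (lexx _) (ltW ax) (ltW xb); lra.
Qed.

Lemma len_adherent g a b e : rectifiable g a b -> 0 < e ->
  exists2 l, itv_partition a b l & curve_len g a b - e < polygon_length g a l.
Proof.
move=> gR e0; apply: contrapT => no.
suff : curve_len g a b <= curve_len g a b - e by lra.
rewrite -lee_fin -lenE//; apply: curve_length_le => l abl.
by rewrite lee_fin leNgt; apply/negP => lt; apply: no; exists l.
Qed.

(** Left continuity of arc length. A polygon misses less than [e / 2] of the length, and by
    [last_edge] it is bounded by the length up to [t] plus a chord, itself below [e / 2] by
    continuity of [g]. *)
Lemma len_left g a b e : rectifiable g a b -> a < b -> 0 < e ->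
  exists2 t, a <= t < b & curve_len g t b < e.
Proof.
move=> gR ab e0; have e2 : 0 < e / 2 by rewrite divr_gt0.
have [l abl le] := len_adherent gR e2.
have [c /andP[ac cb] cP] := last_edge gR ab abl.
have [[_ gc] _] := gR.
have [|d d0 dP] := (within_continuous_mdist _ _).1 gc b _ (e / 2) e2.
  by rewrite /= in_itv/= lexx (ltW ab).
pose t := Num.max c (b - d / 2).
have tb : t < b by rewrite /t gt_max cb/=; lra.
have ct : c <= t by rewrite /t le_max lexx.
have bt : b - d / 2 <= t by rewrite /t le_max lexx orbT.
have at_ := le_trans ac ct.
exists t; first by rewrite at_.
have := cP t ct tb; have := dP t.
have bt0 : 0 <= b - t by lra.
rewrite /= in_itv/= at_ (ltW tb) (ger0_norm bt0) => /(_ isT).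
rewrite (_ : b - t < d); last lra.
move=> /(_ isT); rewrite [mdist (g b) _]metric_sym.
by move: le; rewrite (lenD gR (lexx _) at_ (ltW tb) (lexx _)); lra.
Qed.

Lemma len_right g a b e : rectifiable g a b -> a < b -> 0 < e ->
  exists2 t, a < t <= b & curve_len g a t < e.
Proof.
move=> gR ab e0; have e2 : 0 < e / 2 by rewrite divr_gt0.
have [l abl le] := len_adherent gR e2.
have [[_ gc] _] := gR.
have [|d d0 dP] := (within_continuous_mdist _ _).1 gc a _ (e / 2) e2.
  by rewrite /= in_itv/= lexx (ltW ab).
case: l abl le => [/itv_partition_nil abE|x l abl le]; first by move: ab; rewrite abE ltxx.
have xbl := itv_partition_cons abl; have xb := itv_partition_le xbl.
have [/andP[/= ax _] _] := abl.
pose t := Num.min x (a + d / 2).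
have at_ : a < t by rewrite /t lt_min ax/=; lra.
have tx : t <= x by rewrite /t ge_min lexx.
have td : t <= a + d / 2 by rewrite /t ge_min lexx orbT.
have tb := le_trans tx xb.
exists t; first by rewrite at_.
have at0 : a - t <= 0 by lra.
have := dP t; rewrite /= in_itv/= (ltW at_) tb (ler0_norm at0) => /(_ isT).
rewrite (_ : - (a - t) < d); last lra.
move=> /(_ isT) gat; have := metric_triangle (g a) (g t) (g x).
have := mdist_le_len gR (ltW at_) tx xb.
have : polygon_length g x l <= curve_len g x b.
  rewrite -lee_fin -lenE; first exact: polygon_le_length.
  exact: rectifiable_sub gR (ltW ax) xb _.
move: le; rewrite (lenD gR (lexx _) (ltW at_) tb (lexx _)).
by rewrite (lenD gR (ltW at_) tx xb (lexx _)) /=; lra.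
Qed.

(** An intermediate value argument at the largest parameter with length at most [s]: [len_left]
    shows that the length there does not exceed [s], [len_right] that it is not below. *)
Lemma len_surj g a b s : rectifiable g a b -> 0 <= s <= curve_len g a b ->
  exists2 t, a <= t <= b & curve_len g a t = s.
Proof.
move=> gR /andP[s0 sl]; have [[ab gc] _] := gR.
pose A := [set t | a <= t <= b /\ curve_len g a t <= s].
have Aa : A a by split; rewrite ?lexx// len_nn.
have supA : has_sup A by split; [exists a|exists b => t [/andP[]]].
have at_ : a <= sup A by apply: ub_le_sup => //; exact: supA.2.
have tb : sup A <= b by apply: ge_sup; [exists a|move=> t [/andP[]]].
have : forall u, A u -> u <= sup A by move=> u Au; apply: ub_le_sup => //; exact: supA.2.
have : forall e, 0 < e -> exists2 u, A u & sup A - e < u.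
  by move=> e e0; exact: sup_adherent.
move: (sup A) at_ tb => t at_ tb adh ub; exists t; first by rewrite at_.
apply/eqP; rewrite eq_le; apply/andP; split.
  move: at_; rewrite [a <= t]le_eqVlt => /predU1P[<-|at_]; first by rewrite len_nn.
  apply/ler_addgt0Pl => e e0.
  have gR' : rectifiable g a t by apply: rectifiable_sub gR _ (ltW at_) _.
  have [u /andP[au ut] ute] := len_left gR' at_ e0.
  have [v [/andP[av vb] vs] uv] : exists2 v, A v & u < v.
    have [|v Av] := adh (t - u); first by rewrite subr_gt0.
    by rewrite subKr => uv; exists v.
  rewrite (lenD gR' (lexx _) au (ltW ut))//.
  have := lenD gR (lexx _) au (ltW uv) vb.
  by have := len_ge0 g (ltW uv); lra.
move: tb; rewrite [t <= b]le_eqVlt => /predU1P[->|tb]; first by [].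
rewrite leNgt; apply/negP => ts.
have gR' : rectifiable g t b by apply: rectifiable_sub gR _ (ltW tb) _.
have e0 : 0 < s - curve_len g a t by rewrite subr_gt0.
have [u /andP[tu ub'] tue] := len_right gR' tb e0.
have : u <= t.
  apply: ub; split; first by rewrite ub' (le_trans at_ (ltW tu)).
  by rewrite (lenD gR (lexx _) at_ (ltW tu))//; lra.
by rewrite leNgt tu.
Qed.

Lemma arclength_paramP g a b s : rectifiable g a b -> 0 <= s <= curve_len g a b ->
  exists t, [/\ a <= t <= b, curve_len g a t = s & arclength_param g a b s = g t].
Proof.
move=> gR sl; rewrite /arclength_param; case: xgetP => [t _ [tab ts]|none].
  move: tab; rewrite in_itv/= => tab.
  by exists t; split=> //; rewrite /curve_len ts.
have [t tab ts] := len_surj gR sl; exfalso; apply: (none t).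
split=> /=; first by rewrite in_itv.
have /andP[? ?] := tab.
by rewrite lenE ?ts//; exact: rectifiable_sub gR _ _ _.
Qed.

Lemma arclength_param_mdist g a b s s' : rectifiable g a b ->
  0 <= s <= curve_len g a b -> 0 <= s' <= curve_len g a b ->
  mdist (arclength_param g a b s) (arclength_param g a b s') <= `|s - s'|.
Proof.
move=> gR /(arclength_paramP gR)[t [/andP[at_ tb] <- ->]].
move=> /(arclength_paramP gR)[t' [/andP[at'_ t'b] <- ->]].
have [tt'|/ltW tt'] := leP t t'.
  rewrite (lenD gR (lexx _) at_ tt' t'b) opprD addrA subrr sub0r normrN.
  by apply: le_trans (ler_norm _); exact: mdist_le_len gR _ _ _.
rewrite metric_sym (lenD gR (lexx _) at'_ tt' tb) addrAC subrr add0r.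
by apply: le_trans (ler_norm _); exact: mdist_le_len gR _ _ _.
Qed.

Lemma arclength_paramE g a b t : rectifiable g a b -> a <= t <= b ->
  arclength_param g a b (curve_len g a t) = g t.
Proof.
move=> gR /andP[at_ tb].
have [|t' [/andP[at'_ t'b] tt' ->]] := @arclength_paramP g a b (curve_len g a t) gR.
  by rewrite len_ge0//= (lenD gR (lexx _) at_ tb (lexx _)) lerDl len_ge0.
apply: mdist_positivity; apply/eqP; rewrite eq_le mdist_ge0 andbT.
have [le|/ltW le] := leP t t'.
  rewrite metric_sym; apply: le_trans (mdist_le_len gR at_ le t'b) _.
  by move: tt'; rewrite (lenD gR (lexx _) at_ le t'b); lra.
apply: le_trans (mdist_le_len gR at'_ le tb) _.
by move: tt'; rewrite (lenD gR (lexx _) at'_ le tb); lra.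
Qed.

(* Holds without any continuity: the junk value of the parametrization is g a. *)
Lemma arclength_param_im g a b s : a <= b -> 0 <= s -> exists2 t, a <= t <= b &
  arclength_param g a b s = g t /\ mdist (g a) (g t) <= s.
Proof.
move=> ab s0; rewrite /arclength_param; case: xgetP => [t _ [tab ts]|none].
  move: tab; rewrite in_itv/= => /[dup] tab /andP[at_ tb]; exists t => //.
  by split=> //; rewrite -lee_fin -ts mdist_le_length.
by exists a; rewrite ?lexx// mdistxx.
Qed.

Lemma arclength_param_end g a b : rectifiable g a b ->
  arclength_param g a b 0 = g a /\ arclength_param g a b (curve_len g a b) = g b.
Proof.
move=> gR; have [[ab _] _] := gR.
split; last by rewrite arclength_paramE ?lexx ?ab.
by have := @arclength_paramE g a b a gR; rewrite len_nn lexx ab; exact.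
Qed.

End arclength.


Section concatenation.
Context {R : realType} {X : metricType R}.
Context (g1 g2 : R -> X) (a1 b1 a2 b2 : R).
Context (g1R : rectifiable g1 a1 b1) (g2R : rectifiable g2 a2 b2).
Context (g12 : g1 b1 = g2 a2).

(** Gluing is used for the triangle inequality of the quasihyperbolic distance; the second curve is
    translated so as to start at [b1]. *)
Definition concat_curve (t : R) : X :=
  if t <= b1 then g1 t else g2 (t + (a2 - b1)).

Let c := b1 + (b2 - a2).

Let ab1 : a1 <= b1. Proof. by have [[]] := g1R. Qed.
Let ab2 : a2 <= b2. Proof. by have [[]] := g2R. Qed.

Lemma concat_curvel t : t <= b1 -> concat_curve t = g1 t.
Proof. by rewrite /concat_curve => ->. Qed.

Lemma concat_curver t : b1 <= t -> concat_curve t = g2 (t + (a2 - b1)).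
Proof.
rewrite /concat_curve; case: (ltgtP t b1) => // -> _.
by rewrite g12; congr g2; ring.
Qed.

Lemma concat_lengthl t : t <= b1 -> curve_length concat_curve a1 t = curve_length g1 a1 t.
Proof.
move=> tb; apply: eq_curve_length => u; rewrite in_itv/= => /andP[_ ut].
by rewrite concat_curvel// (le_trans ut).
Qed.

Lemma concat_lengthr t :
  curve_length concat_curve b1 t = curve_length g2 a2 (t + (a2 - b1)).
Proof.
rewrite [LHS](@eq_curve_length _ _ _ (fun t => g2 (t + (a2 - b1)))).
  by rewrite curve_length_shift addrC subrK.
by move=> u; rewrite in_itv/= => /andP[bu _]; exact: concat_curver.
Qed.

Lemma concat_is_curve : is_curve concat_curve a1 c.
Proof.
have [[_ /within_continuous_mdist c1] _] := g1R.
have [[_ /within_continuous_mdist c2] _] := g2R.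
have [ab1' ab2'] := (ab1, ab2).
split; first by rewrite /c; lra.
apply/within_continuous_mdist => t; rewrite /= in_itv/= /c => /andP[at_ tb] e e0.
have e2 : 0 < e / 2 by rewrite divr_gt0.
have [tb1|b1t] := leP t b1.
  have [|d1 d10 d1P] := c1 t _ _ e2; first by rewrite /= in_itv/= at_.
  have [|d2 d20 d2P] := c2 a2 _ _ e2; first by rewrite /= in_itv/= lexx.
  exists (Num.min d1 d2); first by rewrite lt_min d10.
  move=> u; rewrite in_itv/= lt_min => /andP[au ub] /andP[tu1 tu2].
  rewrite (concat_curvel tb1); have [ub1|b1u] := leP u b1.
    rewrite concat_curvel//; have : mdist (g1 t) (g1 u) < e / 2; last by lra.
    by apply: d1P => //; rewrite /= in_itv/= au.
  rewrite concat_curver ?(ltW b1u)//.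
  move: tu1 tu2; rewrite (distrC t) ger0_norm; last lra.
  move=> tu1 tu2.
  have := metric_triangle (g1 t) (g1 b1) (g2 (u + (a2 - b1))).
  have : mdist (g1 t) (g1 b1) < e / 2.
    apply: d1P; first by rewrite /= in_itv/= lexx andbT.
    by rewrite ler0_norm; lra.
  have : mdist (g1 b1) (g2 (u + (a2 - b1))) < e / 2.
    rewrite g12; apply: d2P; first by rewrite /= in_itv/=; apply/andP; split; lra.
    by rewrite ler0_norm; lra.
  by lra.
have [|d d0 dP] := c2 (t + (a2 - b1)) _ _ e0.
  by rewrite /= in_itv/=; apply/andP; split; lra.
exists (Num.min d (t - b1)); first by rewrite lt_min d0 subr_gt0.
move=> u; rewrite in_itv/= lt_min => /andP[au ub] /andP[tu1 tu2].
have b1u : b1 < u by have := ler_norm (t - u); lra.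
rewrite !concat_curver ?(ltW b1t, ltW b1u)//; apply: dP.
  by rewrite /= in_itv/=; apply/andP; split; lra.
by rewrite opprD addrACA subrr addr0.
Qed.

Lemma concat_rectifiable : rectifiable concat_curve a1 c.
Proof.
have [ab1' ab2'] := (ab1, ab2).
split; first exact: concat_is_curve.
rewrite (@curve_lengthD _ _ _ _ b1)//; last by rewrite /c; lra.
rewrite concat_lengthl// concat_lengthr /c.
have -> : b1 + (b2 - a2) + (a2 - b1) = b2 by ring.
by apply: lte_add_pinfty; [exact: g1R.2|exact: g2R.2].
Qed.

Lemma concat_len : curve_len concat_curve a1 c = curve_len g1 a1 b1 + curve_len g2 a2 b2.
Proof.
have [ab1' ab2'] := (ab1, ab2).
rewrite (lenD concat_rectifiable (lexx _) ab1 _ (lexx _)); last by rewrite /c; lra.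
rewrite /curve_len concat_lengthl// concat_lengthr /c.
by have -> : b1 + (b2 - a2) + (a2 - b1) = b2 by ring.
Qed.

Lemma concat_arclengthl s : 0 <= s <= curve_len g1 a1 b1 ->
  arclength_param concat_curve a1 c s = arclength_param g1 a1 b1 s.
Proof.
have [ab1' ab2'] := (ab1, ab2).
move=> /(arclength_paramP g1R)[t [/andP[at_ tb] <- ->]].
rewrite /curve_len -concat_lengthl// -/(curve_len _ _ _) arclength_paramE ?concat_curvel//.
  exact: concat_rectifiable.
by rewrite at_ /c; lra.
Qed.

Lemma concat_arclengthr s : 0 <= s <= curve_len g2 a2 b2 ->
  arclength_param concat_curve a1 c (curve_len g1 a1 b1 + s) = arclength_param g2 a2 b2 s.
Proof.
have [ab1' ab2'] := (ab1, ab2).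
move=> /(arclength_paramP g2R)[t [/andP[at_ tb] <- ->]].
have tE : t = t - (a2 - b1) + (a2 - b1) by rewrite subrK.
have -> : curve_len g1 a1 b1 + curve_len g2 a2 t = curve_len concat_curve a1 (t - (a2 - b1)).
  rewrite (lenD concat_rectifiable (lexx _) ab1); [|by lra|by rewrite /c; lra].
  by rewrite /curve_len concat_lengthl// concat_lengthr -tE.
rewrite arclength_paramE; last by rewrite /c; apply/andP; split; lra.
  by rewrite concat_curver -?tE//; lra.
exact: concat_rectifiable.
Qed.

End concatenation.

(** * Integrals over intervals *)


Section integrals.
Context {R : realType}.
Local Notation mu := (@lebesgue_measure R).
Implicit Types (f : R -> R) (L M m : R).

Lemma within_itv_measurable f (a b : R) : {within `[a, b], continuous f} ->
  measurable_fun `[a, b] (EFin \o f).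
Proof.
by move=> fc; apply/measurable_EFinP; exact: subspace_continuous_measurable_fun.
Qed.

Lemma integral_le_cst f L M : 0 <= L -> {within `[0, L], continuous f} ->
  (forall s, 0 <= s <= L -> 0 <= f s <= M) ->
  (\int[mu]_(s in `[0%R, L]) (f s)%:E <= (M * L)%:E)%E.
Proof.
move=> L0 fc fM.
apply: (@le_trans _ _ (\int[mu]_(s in `[0%R, L]) cst M%:E s)%E).
  apply: ge0_le_integral => //.
  - by move=> s /=; rewrite in_itv/= lee_fin => /fM /andP[].
  - exact: within_itv_measurable.
  - by move=> s /=; rewrite in_itv/= lee_fin => /fM /andP[].
rewrite integral_cst//= lebesgue_measure_itv/= lte_fin; case: ifP => _.
  by rewrite -EFinB subr0 -EFinM.
rewrite mule0 lee_fin mulr_ge0//.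
have /andP[f0 fM0] : 0 <= f 0 <= M by apply: fM; rewrite lexx.
exact: le_trans fM0.
Qed.

Lemma integral_ge_cst f l L m : 0 <= l -> l <= L -> 0 <= m ->
  {within `[0, L], continuous f} -> (forall s, 0 <= s <= L -> 0 <= f s) ->
  (forall s, 0 <= s <= l -> m <= f s) ->
  ((m * l)%:E <= \int[mu]_(s in `[0%R, L]) (f s)%:E)%E.
Proof.
move=> l0 lL m0 fc f0 fm.
have sub : `[0, l] `<=` `[0, L].
  by move=> s /=; rewrite !in_itv/= => /andP[-> /le_trans]; exact.
have mf := within_itv_measurable fc.
apply: (@le_trans _ _ (\int[mu]_(s in `[0%R, l]) (f s)%:E)%E); last first.
  apply: ge0_subset_integral => // s /=; rewrite in_itv/= lee_fin; exact: f0.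
apply: (@le_trans _ _ (\int[mu]_(s in `[0%R, l]) cst m%:E s)%E).
  rewrite integral_cst//= lebesgue_measure_itv/= lte_fin.
  move: l0; rewrite [0 <= l]le_eqVlt => /predU1P[<-|->].
    by rewrite ltxx mule0 mulr0.
  by rewrite -EFinB subr0 -EFinM.
apply: ge0_le_integral => //; exact: measurable_funS mf.
Qed.

Lemma integral_shift f a b c : a <= b -> {within `[a + c, b + c], continuous f} ->
  (\int[mu]_(s in `[(a + c)%R, (b + c)%R]) (f s)%:E =
   \int[mu]_(s in `[a, b]) (f (s + c)%R)%:E)%E.
Proof.
move=> ab fc.
have dE : derive1 (fun x : R => x + c) = cst 1.
  by apply/funext => x; rewrite derive1E deriveD// derive_id derive_cst addr0.
have := @integration_by_substitution_increasing R (fun x => x + c) f a b ab.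
rewrite dE => ->//.
- by apply: eq_integral => x _ /=; rewrite mulr1.
- by move=> x y _ _ xy; rewrite ltrD2r.
- by move=> x _; exact: cvg_cst.
- exact: is_cvg_cst.
- exact: is_cvg_cst.
- split => /=.
  + by move=> x _; exact: derivableD.
  + by apply: cvg_at_right_filter; apply: cvgD => //; exact: cvg_cst.
  + by apply: cvg_at_left_filter; apply: cvgD => //; exact: cvg_cst.
Qed.

Lemma integral_concat f f1 f2 L1 L2 : 0 <= L1 -> 0 <= L2 ->
  {within `[0, L1 + L2], continuous f} ->
  (forall s, 0 <= s <= L1 + L2 -> 0 <= f s) ->
  (forall s, 0 <= s <= L1 -> f s = f1 s) ->
  (forall s, 0 <= s <= L2 -> f (L1 + s) = f2 s) ->
  (\int[mu]_(s in `[0%R, (L1 + L2)%R]) (f s)%:E =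
   \int[mu]_(s in `[0%R, L1]) (f1 s)%:E + \int[mu]_(s in `[0%R, L2]) (f2 s)%:E)%E.
Proof.
move=> L10 L20 fc f0 fE1 fE2.
have sE : `[0, L1 + L2]%classic = `[0, L1] `|` `]L1, L1 + L2] :> set R.
  apply/seteqP; split=> s /=; rewrite !in_itv/=.
    by case: (leP s L1) => sL /andP[s0 sL2]; [left; rewrite s0|right].
  by case=> /andP[h1 h2]; apply/andP; split; lra.
have mf := within_itv_measurable fc.
rewrite sE ge0_integral_setU//=; last 3 first.
- by rewrite -sE.
- move=> s sL; rewrite lee_fin; apply: f0.
  have : `[0, L1 + L2]%classic s by rewrite sE.
  by rewrite /= in_itv.
- apply/disj_setPRL => s /=; rewrite !in_itv/= => /andP[sL _].
  by apply/negP; rewrite negb_and -!ltNge sL orbT.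
congr (_ + _)%E.
  by apply: eq_integral => s; rewrite inE/= in_itv/= => s1; rewrite fE1.
rewrite integral_itv_obnd_cbnd; last first.
  by apply: measurable_funS mf => //; rewrite sE; exact: subsetUr.
rewrite -{1}(add0r L1) (addrC L1) integral_shift//; last first.
  apply: continuous_subspaceW fc => s /=; rewrite !in_itv/=.
  by move=> /andP[h1 h2]; apply/andP; split; lra.
by apply: eq_integral => s; rewrite inE/= in_itv/= => s2; rewrite addrC fE2.
Qed.

End integrals.

(** * The quasihyperbolic distance *)


Section boundary.
Context {R : realType} {X : metricType R} (Xbar : completion X).
Local Notation emb := (completion_emb Xbar).
Local Notation D := (dist_boundary Xbar).

(** Guards against the default value of an infimum over the empty set in [dist_boundary]. With empty
    boundary the embedding is a surjective isometry, and limits in the completion pull back to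
    [X]. *)
Lemma metric_boundary_nonempty : ~ complete_space X ->
  metric_boundary (Xbar := Xbar) !=set0.
Proof.
move=> ncX; apply: contrapT => /set0P/negP/negPn/eqP bd0; apply: ncX => F FF cF.
have surj w : exists x, emb x = w.
  apply: contrapT => nx; have : metric_boundary (Xbar := Xbar) w.
    by case=> x _ xw; apply: nx; exists x.
  by rewrite bd0.
have [|w Fw] := completion_complete (c := Xbar) (fmap_proper_filter emb FF).
  apply/cauchy_ballP => e e0; move/cauchy_ballP : cF => /(_ e e0).
  case=> -[A B] /= [FA FB] AB; exists (emb @` A, emb @` B) => /=.
    split; first by apply: filterS FA => x Ax; exists x.
    by apply: filterS FB => x Bx; exists x.
  move=> [_ _] /= [[x Ax <-] [y By <-]].
  by have := AB (x, y) (conj Ax By); rewrite /= !ballEmdist/= completion_isometry.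
have [x xw] := surj w; exists x.
apply/metricType_numDomainType.fcvgrPdist_lt => e e0.
move/metricType_numDomainType.fcvgrPdist_lt : Fw => /(_ e e0).
rewrite -xw => nF; have {}nF : F [set y | mdist (emb x) (emb y) < e] by [].
by apply: filterS nF => y; rewrite /= completion_isometry.
Qed.

Context (bd_neq0 : metric_boundary (Xbar := Xbar) !=set0).

Lemma dist_boundary_has_inf x :
  has_inf [set mdist (emb x) w | w in metric_boundary (Xbar := Xbar)].
Proof.
split; first by have [w bw] := bd_neq0; exists (mdist (emb x) w), w.
by exists 0 => _ [w _ <-]; exact: mdist_ge0.
Qed.

Lemma dist_boundary_lip x y : D y <= D x + mdist x y.
Proof.
rewrite -lerBlDr; apply: lb_le_inf; first exact: (dist_boundary_has_inf x).1.
move=> _ [w bw <-]; rewrite lerBlDr -(completion_isometry Xbar).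
have h : D y <= mdist (emb y) w.
  by apply: ge_inf; [exact: (dist_boundary_has_inf y).2|exists w].
apply: le_trans h _; have := metric_triangle (emb y) (emb x) w.
by rewrite (metric_sym (emb y) (emb x)); lra.
Qed.

(** A compact neighbourhood of [x] has a compact, hence closed, image in the completion. A boundary
    point too close to [x] would be, by density, a limit of points of this image, hence in the
    range. *)
Lemma dist_boundary_gt0 : locally_compact [set: X] -> forall x, 0 < D x.
Proof.
move=> lc x; have [U + [cU _]] := lc x I.
rewrite /within/= => xU.
have {xU} /nbhs_ballP[e /= e0 eU] : nbhs x U by apply: filterS xU => y; exact.
have e2 : 0 < e / 2 by rewrite divr_gt0.
apply: lt_le_trans e2 _; apply: lb_le_inf; first exact: (dist_boundary_has_inf x).1.
move=> _ [w bw <-]; rewrite leNgt; apply/negP => xw; apply: bw.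
have embc : continuous emb.
  move=> y; apply/metricType_numDomainType.cvgrPdist_lt => d d0.
  by apply/nbhs_ballP; exists d => //= z; rewrite completion_isometry ballEmdist.
have : closed (emb @` U).
  apply: compact_closed; first exact: metric_hausdorff.
  by apply: continuous_compact => //; exact: continuous_subspaceT.
move/closure_id => clU; suff : closure (emb @` U) w.
  by rewrite -clU => -[y _ <-]; exists y.
move=> B /nbhs_ballP[d /= d0 dB].
have dw0 : 0 < Num.min d (e / 2) by rewrite lt_min d0 divr_gt0.
have O0 : (ball w (Num.min d (e / 2)))° !=set0 by exists w; exact: nbhsx_ballx.
have [w' [/= wy [y _ yE]]] := completion_dense O0 (open_interior _).
move: wy => /interior_subset; rewrite -yE ballEmdist/= lt_min => /andP[wy1 wy2].
exists (emb y); split; last by apply: dB; rewrite ballEmdist.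
exists y => //; apply: eU; rewrite ballEmdist/= -(completion_isometry Xbar).
by have := metric_triangle (emb x) w (emb y); lra.
Qed.

End boundary.


Section quasihyperbolic_metric.
Context {R : realType} {X : metricType R} (Xbar : completion X).
Local Notation D := (dist_boundary Xbar).
Local Notation k := (qh_dist Xbar).
Local Notation P := arclength_param.
Local Notation qh_length := (line_integral (fun z => (D z)^-1)).

Context (D0 : forall x, 0 < D x).
Context (D_lip : forall x y, D y <= D x + mdist x y).
Context (rect_conn : forall x y : X, exists g a b,
  rectifiable g a b /\ joins g a b x y).
Implicit Types (g : R -> X) (x y z : X).

Lemma dist_boundary_arclength_continuous g a b : rectifiable g a b ->
  {within `[0, curve_len g a b], continuous (fun s => D (P g a b s))}.
Proof.
move=> gR; apply/subspace_continuousP => s /=; rewrite in_itv/= => sL.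
apply/cvgrPdist_lt => e e0; rewrite near_withinE; apply/nbhs_ballP.
exists e => // u /= su; rewrite in_itv/= => uL.
apply: le_lt_trans su; have := arclength_param_mdist gR sL uL.
have := D_lip (P g a b s) (P g a b u).
have := D_lip (P g a b u) (P g a b s).
rewrite (metric_sym (P g a b u)) ler_norml; lra.
Qed.

Lemma dist_boundary_inv_arclength_continuous g a b : rectifiable g a b ->
  {within `[0, curve_len g a b], continuous (fun s => (D (P g a b s))^-1)}.
Proof.
move=> /dist_boundary_arclength_continuous /subspace_continuousP Dc.
apply/subspace_continuousP => s sL; apply: cvgV; last exact: Dc.
by rewrite gt_eqF.
Qed.

Lemma qh_length_ge0 g a b : (0 <= qh_length g a b)%E.
Proof. by apply: integral_ge0 => s _; rewrite lee_fin invr_ge0 ltW. Qed.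

Lemma qh_length_le g a b m : rectifiable g a b -> 0 < m ->
  (forall t, a <= t <= b -> m <= D (g t)) ->
  (qh_length g a b <= (m^-1 * curve_len g a b)%:E)%E.
Proof.
move=> gR m0 Dm; have [[ab _] _] := gR.
apply: integral_le_cst => [||s /andP[s0 sL]]; first exact: len_ge0.
  exact: dist_boundary_inv_arclength_continuous.
have [t tab [-> _]] := arclength_param_im g ab s0.
by rewrite invr_ge0 ltW//= lef_pV2 ?posrE// Dm.
Qed.

Lemma qh_length_fin g a b : rectifiable g a b -> qh_length g a b \is a fin_num.
Proof.
move=> gR; rewrite ge0_fin_numE ?qh_length_ge0//.
have [[ab _] _] := gR.
have L0 := len_ge0 g ab.
have [s sL smin] := EVT_min L0 (dist_boundary_arclength_continuous gR).
apply: le_lt_trans (qh_length_le gR (D0 (P g a b s)) _) (ltry _) => t tab.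
rewrite -(arclength_paramE gR tab); apply: smin.
have /andP[at_ tb] := tab.
by rewrite in_itv/= len_ge0//= (lenD gR (lexx _) at_ tb (lexx _)) lerDl len_ge0.
Qed.

Let qh_lengths x y := [set r | exists g a b,
  [/\ rectifiable g a b, joins g a b x y & r = qh_length g a b]].

Lemma qh_distE x y : (k x y)%:E = ereal_inf (qh_lengths x y).
Proof.
rewrite /qh_dist fineK// ge0_fin_numE.
  have [g [a [b [gR gxy]]]] := rect_conn x y.
  apply: le_lt_trans (_ : qh_length g a b < +oo)%E.
    by apply: ge_ereal_inf; exists (qh_length g a b) => //; exists g, a, b.
  by rewrite -ge0_fin_numE ?qh_length_ge0 ?qh_length_fin.
by apply: le_ereal_inf_tmp => _ [g [a [b [_ _ ->]]]]; exact: qh_length_ge0.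
Qed.

Lemma qh_dist_le_length g a b : rectifiable g a b ->
  ((k (g a) (g b))%:E <= qh_length g a b)%E.
Proof.
move=> gR; rewrite qh_distE; apply: ge_ereal_inf; exists (qh_length g a b) => //.
by exists g, a, b.
Qed.

Lemma qh_dist_ge x y M : (forall g a b, rectifiable g a b -> joins g a b x y ->
  (M%:E <= qh_length g a b)%E) -> M <= k x y.
Proof.
move=> le; rewrite -lee_fin qh_distE; apply: le_ereal_inf_tmp.
by move=> _ [g [a [b [gR gxy ->]]]]; exact: le.
Qed.

Lemma qh_dist_le_len g a b m : rectifiable g a b -> 0 < m ->
  (forall t, a <= t <= b -> m <= D (g t)) -> k (g a) (g b) <= curve_len g a b / m.
Proof.
move=> gR m0 Dm; rewrite -lee_fin mulrC.
exact: le_trans (qh_dist_le_length gR) (qh_length_le gR m0 Dm).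
Qed.

(** A curve from [x] to [y] stays, during its first [l] units of length, within [l <= D x] of [x],
    where [D] is at most [2 * D x]; hence [l <= 2 * k x y * D x]. As [k x y < 2^-1], this is less
    than [D x], so the minimum [l] is [mdist x y]. *)
Lemma mdist_le_qh_dist x y : k x y < 2^-1 -> mdist x y <= 2 * k x y * D x.
Proof.
move=> k2; pose l := Num.min (mdist x y) (D x).
have l0 : 0 <= l by rewrite le_min mdist_ge0 ltW.
have kl : (2 * D x)^-1 * l <= k x y.
  apply: qh_dist_ge => g a b gR [ga gb]; have [[ab _] _] := gR.
  apply: integral_ge_cst => //.
  - apply: (@le_trans _ _ (mdist x y)); first by rewrite /l ge_min lexx.
    by rewrite -ga -gb; exact: mdist_le_len gR _ _ _.
  - by rewrite invr_ge0 mulr_ge0// ltW.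
  - exact: dist_boundary_inv_arclength_continuous.
  - by move=> s _; rewrite invr_ge0 ltW.
  move=> s /andP[s0 sl]; have [t _ [-> gt]] := arclength_param_im g ab s0.
  rewrite lef_pV2 ?posrE ?mulr_gt0//; apply: le_trans (D_lip x (g t)) _.
  have lD : l <= D x by rewrite /l ge_min lexx orbT.
  by rewrite ga in gt; lra.
have lk : l <= 2 * k x y * D x.
  by move: kl; rewrite mulrC ler_pdivrMr ?mulr_gt0//; lra.
move: lk; rewrite /l; case: (leP (mdist x y) (D x)) => // _.
by have := D0 x; nra.
Qed.

Lemma qh_length_concat g1 g2 a1 b1 a2 b2 : rectifiable g1 a1 b1 ->
  rectifiable g2 a2 b2 -> g1 b1 = g2 a2 ->
  qh_length (concat_curve g1 g2 b1 a2) a1 (b1 + (b2 - a2)) =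
  (qh_length g1 a1 b1 + qh_length g2 a2 b2)%E.
Proof.
move=> g1R g2R g12; have [[ab1 _] _] := g1R; have [[ab2 _] _] := g2R.
have cR := concat_rectifiable g1R g2R g12.
rewrite /line_integral -!/(curve_len _ _ _) concat_len//.
apply: integral_concat => [||||s sL|s sL]; [exact: len_ge0..| | | |].
- by rewrite -concat_len//; exact: dist_boundary_inv_arclength_continuous.
- by move=> s _; rewrite invr_ge0 ltW.
- by rewrite concat_arclengthl.
- by rewrite concat_arclengthr.
Qed.

Lemma qh_dist_triangle y x z : k x z <= k x y + k y z.
Proof.
rewrite -lerBlDr; apply: qh_dist_ge => g1 a1 b1 g1R [g1a g1b].
rewrite -(fineK (qh_length_fin g1R)) lee_fin lerBlDr -lerBlDl.
apply: qh_dist_ge => g2 a2 b2 g2R [g2a g2b].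
have g12 : g1 b1 = g2 a2 by rewrite g1b g2a.
have [[ab1 _] _] := g1R; have [[ab2 _] _] := g2R.
rewrite -(fineK (qh_length_fin g2R)) lee_fin lerBlDl -lee_fin EFinD.
rewrite (fineK (qh_length_fin g1R)) (fineK (qh_length_fin g2R)) -qh_length_concat//.
have := qh_dist_le_length (concat_rectifiable g1R g2R g12).
rewrite concat_curvel// concat_curver//; last by lra.
have -> : b1 + (b2 - a2) + (a2 - b1) = b2 by ring.
by rewrite g1a g2b.
Qed.

(** Vanishing on the diagonal and symmetry are read off from a geodesic parametrization, which
    spares reversing curves inside the line integral. *)
Lemma qh_distance_function : geodesic_space k -> distance_function k.
Proof.
move=> geo; split; last exact: qh_dist_triangle.
- move=> x; have [_ [g [a [b [[ab gE] [ga gb] _]]]]] := geo x x.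
  by rewrite -{1}ga -ga gE ?in_itv/= ?lexx ?ab// subrr normr0.
- move=> x y; have [_ [g [a [b [[ab gE] [<- <-] _]]]]] := geo x y.
  by rewrite !gE ?in_itv/= ?lexx ?ab// distrC.
Qed.

End quasihyperbolic_metric.

(** * John arcs *)


Lemma bernoulli_ineq {R : realType} (x : R) n : 0 <= x -> 1 + n%:R * x <= (1 + x) ^+ n.
Proof.
move=> x0; elim: n => [|n IH]; first by rewrite mul0r addr0 expr0.
have n0 : 0 <= n%:R :> R by [].
by rewrite exprS -natr1; nra.
Qed.

Section cone_arcs.
Context {R : realType} {X : metricType R} (k : X -> X -> R) (D : X -> R).
Context (D0 : forall x, 0 < D x) (D_lip : forall x y, D y <= D x + mdist x y).

(** [P] stands for half of a cone arc by arc length. With [A = 2 * c + 1], the cone condition gives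
    [l + s <= A * D (P s)]. The ratio [q = 1 + A^-1] makes the [i]-th step of length at most
    [l * q ^+ i / A], a lower bound for [D] on that step, so its quasihyperbolic length is at most
    1. *)
Lemma cone_arc_chain (c : R) (P : R -> X) (L : R) : 1 <= c -> 0 <= L ->
  (forall s, 0 <= s <= L -> mdist (P 0) (P s) <= s) ->
  (forall s s' m, 0 <= s -> s <= s' -> s' <= L -> 0 < m ->
     (forall u, s <= u <= s' -> m <= D (P u)) -> k (P s) (P s') <= (s' - s) / m) ->
  (forall s, 0 <= s <= L -> s <= c * D (P s)) ->
  exists n w, cone_chain k D (ln (1 + (2 * c + 1)^-1)) (2 * (2 * c + 1)) (P 0) n w /\
    w n = P L.
Proof.
move=> c1 L0 Plip kP cone; set A := 2 * c + 1; set q := 1 + A^-1.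
have A3 : 3 <= A by rewrite /A; lra.
have A0 : 0 < A by lra.
have Ai0 : 0 < A^-1 by rewrite invr_gt0.
have Ai1 : A^-1 <= 1 by rewrite invf_le1//; lra.
have q1 : 1 < q by rewrite /q; lra.
have qE i : expR (ln q * i%:R) = q ^+ i.
  by rewrite mulrC expRM_natl lnK// posrE; lra.
set l := D (P 0); have l0 : 0 < l by exact: D0.
have lo s : 0 <= s <= L -> l + s <= A * D (P s).
  move=> sL; have := D_lip (P s) (P 0); have := Plip s sL; have := cone s sL.
  by rewrite metric_sym /A -/l; lra.
have hi s : 0 <= s <= L -> D (P s) <= l + s.
  by move=> sL; have := D_lip (P 0) (P s); have := Plip s sL; rewrite -/l; lra.
have exn : exists n, L <= l * (q ^+ n - 1).
  exists (Num.bound (L * A / l)).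
  set n := Num.bound _; have : L * A / l < n%:R.
    by apply: archi_boundP; rewrite divr_ge0 ?(ltW l0)// mulr_ge0 ?(ltW A0).
  rewrite ltr_pdivrMr// => Ln.
  apply: (@le_trans _ _ (l * (n%:R * A^-1))).
    by rewrite mulrA ler_pdivlMr// (mulrC l) ltW.
  by rewrite ler_pM2l//; have := bernoulli_ineq n (ltW Ai0); rewrite -/q; lra.
have [n nL nmin] := ex_minnP exn.
(* The arc length at which [l] plus arc length equals [l * q ^+ i], truncated so that the last
   vertex is [P L]. *)
pose S i := Num.min (l * (q ^+ i - 1)) L.
have q_ge1 i : 1 <= q ^+ i by rewrite exprn_ege1// ltW.
have S0 i : 0 <= S i <= L.
  rewrite /S le_min L0 ge_min lexx orbT !andbT.
  by rewrite mulr_ge0 ?(ltW l0)// subr_ge0.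
exists n, (P \o S); split; last by rewrite /= /S (min_idPr nL).
split=> [|i i_n|i i_n|i i_n] /=; rewrite ?qE -?/l.
- by rewrite /S expr0 subrr mulr0 (min_idPl L0).
- have /andP[Si0 SiL] := S0 i; have /andP[_ SSL] := S0 i.+1.
  have SS : S i <= S i.+1.
    rewrite /S le_min ge_min [X in _ && X]ge_min lexx orbT andbT.
    by rewrite ler_pM2l// lerD2r ler_eXn2l ?leqnSn.
  have m0 : 0 < (l + S i) / A by rewrite divr_gt0// ltr_pwDl.
  apply: le_trans (kP _ _ ((l + S i) / A) Si0 SS SSL m0 _) _.
    move=> u /andP[Su uS]; rewrite ler_pdivrMr// mulrC.
    have := lo u; rewrite (le_trans Si0 Su) (le_trans uS SSL) => /(_ isT); lra.
  rewrite ler_pdivrMr// mul1r ler_pdivlMr//.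
  have := q_ge1 i => qi.
  rewrite {1}/S; case: (leP (l * (q ^+ i.+1 - 1)) L) => h.
    have hS : S i = l * (q ^+ i - 1).
      apply/min_idPl; apply: le_trans h.
      by rewrite ler_pM2l// lerD2r ler_eXn2l ?leqnSn.
    have qA : q * A = A + 1 by rewrite /q mulrDl mul1r mulVf// gt_eqF.
    rewrite hS exprS.
    have -> : (l * (q * q ^+ i - 1) - l * (q ^+ i - 1)) * A =
      l * q ^+ i * (q * A - A) by ring.
    by rewrite qA; lra.
  rewrite /S; case: (leP (l * (q ^+ i - 1)) L) => h'; last first.
    by rewrite subrr mul0r; lra.
  have qA : q * A = A + 1 by rewrite /q mulrDl mul1r mulVf// gt_eqF.
  apply: (@le_trans _ _ ((l * (q ^+ i.+1 - 1) - l * (q ^+ i - 1)) * A)).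
    by rewrite ler_pM2r//; lra.
  rewrite exprS.
  have -> : (l * (q * q ^+ i - 1) - l * (q ^+ i - 1)) * A =
    l * q ^+ i * (q * A - A) by ring.
  by rewrite qA; lra.
(* The factor 2 pays for truncation: by minimality of [n], a truncated vertex is at most one step
   beyond [L], and [q <= 2]. *)
- have := lo _ (S0 i); suff : l * q ^+ i <= 2 * (l + S i) by lra.
  have qi := q_ge1 i; have lq : l <= l * q ^+ i by rewrite ler_pMr.
  rewrite /S; case: (leP (l * (q ^+ i - 1)) L) => h; first lra.
  case: i i_n h {qi lq} => [|i] i_n h; first by rewrite expr0; lra.
  have : l * (q ^+ i - 1) < L.
    by rewrite ltNge; apply/negP => /nmin; rewrite leqNgt i_n.
  have lqi : 0 < l * q ^+ i by rewrite mulr_gt0// (lt_le_trans ltr01).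
  have qE2 : q <= 2 by rewrite /q; lra.
  by rewrite exprS => h2; rewrite mulrCA; nra.
- apply: le_trans (hi _ (S0 i)) _.
  have : S i <= l * (q ^+ i - 1) by rewrite /S ge_min lexx.
  have : 0 < l * q ^+ i by rewrite mulr_gt0// (lt_le_trans ltr01).
  move=> h1 h2; apply: (@le_trans _ _ (l * q ^+ i)); first lra.
  by rewrite ler_pMl//; lra.
Qed.

End cone_arcs.


Lemma curve_bounded {R : realType} {X : metricType R} (g : R -> X) a b :
  is_curve g a b -> exists M : R, forall t, a <= t <= b -> mdist (g a) (g t) <= M.
Proof.
move=> [ab gc].
have fc : {within `[a, b], continuous (fun t => mdist (g a) (g t))}.
  apply/subspace_continuousP => t tab; apply/cvgrPdist_lt => e e0.
  have [d d0 dP] := (within_continuous_mdist _ _).1 gc t tab e e0.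
  rewrite near_withinE; apply/nbhs_ballP; exists d => // u tu uab.
  apply: le_lt_trans (dP u uab tu).
  have := metric_triangle (g a) (g t) (g u).
  have := metric_triangle (g a) (g u) (g t).
  by rewrite (metric_sym (g u)) /from_subspace ler_norml; lra.
have [t _ tmax] := EVT_max ab fc; exists (mdist (g a) (g t)) => u uab.
by apply: tmax; rewrite in_itv.
Qed.

Section john_arcs.
Context {R : realType} {X : metricType R} (Xbar : completion X).
Local Notation D := (dist_boundary Xbar).
Local Notation k := (qh_dist Xbar).
Context (D0 : forall x, 0 < D x) (D_lip : forall x y, D y <= D x + mdist x y).

(** The cone condition bounds only the smaller of two lengths, so total length is not finite by
    definition. [D] is bounded on the arc, so each point is within bounded length [M] of one of the
    two ends. *)
Lemma double_cone_arc_rectifiable c g a b : 1 <= c ->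
  double_cone_arc Xbar c g a b -> rectifiable g a b.
Proof.
move=> c1 [[gc _] cone]; split=> //; have [ab _] := gc.
have [B gB] := curve_bounded gc.
pose M := c * (D (g a) + B).
have short t : a <= t <= b ->
    (curve_length g a t <= M%:E)%E \/ (curve_length g t b <= M%:E)%E.
  move=> tab; have := cone t; rewrite in_itv/= => /(_ tab); rewrite ge_min.
  have cM : c * D (g t) <= M.
    rewrite /M ler_wpM2l//; first lra.
    by apply: le_trans (D_lip (g a) _) _; rewrite lerD2l gB.
  by case/orP => h; [left|right]; apply: le_trans h _; rewrite lee_fin.
have jump u v : a <= u <= b -> a <= v <= b -> mdist (g u) (g v) <= B + B.
  move=> uab vab; have := metric_triangle (g u) (g a) (g v).
  by have := gB u uab; have := gB v vab; rewrite (metric_sym (g u) (g a)); lra.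
(* An edge from a point close to a to a point close to b is the only part of a
   polygon which is not bounded by M. *)
have step u l : a <= u -> (curve_length g a u <= M%:E)%E -> itv_partition u b l ->
    (curve_length g a u + (polygon_length g u l)%:E <= (M + (B + B + M))%:E)%E.
  have aab : a <= a <= b by rewrite lexx.
  have B0 : 0 <= B + B by apply: le_trans (jump a a aab aab); exact: mdist_ge0.
  have M0 : 0 <= M.
    rewrite -lee_fin; have [h|h] := short a aab.
      by apply: le_trans h; exact: curve_length_ge0.
    by apply: le_trans h; exact: curve_length_ge0.
  elim: l u => [|x l IH] u au uM ubl.
    by rewrite /= adde0; apply: le_trans uM _; rewrite lee_fin; lra.
  have xbl := itv_partition_cons ubl; have xb := itv_partition_le xbl.
  have [/andP[/= /ltW ux _] _] := ubl.
  have ub := le_trans ux xb; have ax := le_trans au ux.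
  have axb : a <= x <= b by rewrite ax.
  have [h|h] := short x axb.
    apply: le_trans (IH x ax h xbl).
    rewrite (curve_lengthD g au ux) EFinD addeA leeD2r// leeD2l//.
    exact: mdist_le_length.
  rewrite (_ : (M + (B + B + M))%:E = M%:E + (B + B + M)%:E)%E//.
  apply: leeD => //; rewrite lee_fin; apply: lerD.
    by apply: jump; rewrite ?au ?ax.
  by rewrite -lee_fin; apply: le_trans h; exact: polygon_le_length.
apply: (@le_lt_trans _ _ (M + (B + B + M))%:E); last exact: ltry.
apply: curve_length_le => l abl; have := step a l (lexx _).
rewrite curve_length_nn add0e; apply => //.
have aab : a <= a <= b by rewrite lexx.
by have [h|h] := short a aab; apply: le_trans h; exact: curve_length_ge0.
Qed.

Context (rect_conn : forall x y : X, exists g a b,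
  rectifiable g a b /\ joins g a b x y).
Context (k_dist : distance_function k).

Lemma arclength_qh_dist g a b s s' m : rectifiable g a b ->
  0 <= s -> s <= s' -> s' <= curve_len g a b -> 0 < m ->
  (forall u, s <= u <= s' -> m <= D (arclength_param g a b u)) ->
  k (arclength_param g a b s) (arclength_param g a b s') <= (s' - s) / m.
Proof.
move=> gR s0 ss sL m0 Dm.
have [|t [/andP[at_ tb] ts tE]] := @arclength_paramP _ _ g a b s gR.
  by rewrite s0 (le_trans ss).
have [|t' [/andP[at'_ t'b] ts' tE']] := @arclength_paramP _ _ g a b s' gR.
  by rewrite (le_trans s0 ss).
have [tt'|/ltW tt'] := leP t t'; last first.
  have sE : s = s'.
    have := lenD gR (lexx _) at'_ tt' tb; have := len_ge0 g tt'.
    by rewrite ts ts'; lra.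
  by have [kxx _ _] := k_dist; rewrite sE kxx subrr mul0r.
rewrite tE tE'; have gR' := rectifiable_sub gR at_ tt' t'b.
have st := lenD gR (lexx _) at_ tt' t'b; rewrite ts ts' in st.
have -> : s' - s = curve_len g t t' by lra.
apply: qh_dist_le_len => // u /andP[tu ut'].
have au := le_trans at_ tu; have ub := le_trans ut' t'b.
rewrite -(arclength_paramE gR (t := u)) ?au//; apply: Dm.
have := lenD gR (lexx _) at_ tu ub; have := lenD gR (lexx _) au ut' t'b.
by have := len_ge0 g tu; have := len_ge0 g ut'; rewrite ts ts'; lra.
Qed.

(** The John arc is cut at the midpoint of its arc length: on each half, the smaller of the two
    lengths is the one to the endpoint of that half. The two chains meet at the midpoint. *)
Lemma john_cone_chains c : 1 <= c -> john_with Xbar c -> forall x y,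
  exists n w n' w',
    [/\ cone_chain k D (ln (1 + (2 * c + 1)^-1)) (2 * (2 * c + 1)) x n w,
        cone_chain k D (ln (1 + (2 * c + 1)^-1)) (2 * (2 * c + 1)) y n' w' &
        w n = w' n'].
Proof.
have [kxx ksym ktri] := k_dist.
move=> c1 john x y; have [g [a [b [arc [ga gb]]]]] := john x y.
have gR := double_cone_arc_rectifiable c1 arc; have [[ab _] _] := gR.
have [P0 PL] := arclength_param_end gR.
set P := arclength_param g a b in P0 PL; set L := curve_len g a b in PL.
have L0 : 0 <= L by exact: len_ge0.
have cone s : 0 <= s <= L -> s <= c * D (P s) \/ L - s <= c * D (P s).
  move=> sL; have [t [/andP[at_ tb] ts tE]] := arclength_paramP gR sL.
  rewrite /P tE; have := arc.2 t; rewrite in_itv/= at_ tb => /(_ isT).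
  have := lenD gR (lexx _) at_ tb (lexx _); rewrite ts -/L => Ls.
  rewrite ge_min !(lenE (rectifiable_sub gR _ _ _))// ts !lee_fin.
  have -> : curve_len g t b = L - s by lra.
  by case/orP => h; [left|right].
have h0 : 0 <= L / 2 by lra.
have [|||n [w [cw wn]]] := @cone_arc_chain _ _ k D D0 D_lip c P (L / 2) c1 h0.
- move=> s sL; have := @arclength_param_mdist _ _ g a b 0 s gR.
  rewrite sub0r normrN ger0_norm; last by case/andP: sL.
  by apply; apply/andP; split; rewrite -?/L; lra.
- move=> s s' m s0 ss sL m0 Dm; apply: arclength_qh_dist => //; rewrite -/L; lra.
- by move=> s sL; have [||] := cone s; lra.
have [|||n' [w' [cw' wn']]] :=
    @cone_arc_chain _ _ k D D0 D_lip c (fun s => P (L - s)) (L / 2) c1 h0.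
- move=> s sL; have := @arclength_param_mdist _ _ g a b (L - 0) (L - s) gR.
  have -> : L - 0 - (L - s) = s by ring.
  rewrite ger0_norm; last by case/andP: sL.
  by apply; apply/andP; split; rewrite -?/L; lra.
- move=> s s' m s0 ss sL m0 Dm; rewrite ksym.
  have -> : s' - s = (L - s) - (L - s') by ring.
  apply: arclength_qh_dist => //; rewrite -?/L; try lra.
  move=> u us; have -> : u = L - (L - u) by ring.
  by apply: Dm; lra.
- by move=> s sL; have [||] := cone (L - s); lra.
exists n, w, n', w'; split.
- by rewrite -ga -P0.
- by move: cw'; rewrite subr0 PL gb.
- by rewrite wn wn'; congr P; lra.
Qed.

End john_arcs.

(** * Quasihyperbolic geodesics *)


Section geodesics.
Context {R : realType} {X : metricType R} (rho : X -> X -> R) (D : X -> R).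
Context (D0 : forall x, 0 < D x) (D_lip : exp_lipschitz rho D).
Context (rho_loc : forall x y, rho x y < 2^-1 -> mdist x y <= 2 * rho x y * D x).
Context (rho_dist : distance_function rho).

(** A geodesic is isometric for [rho], whereas an arc has to be continuous for [mdist]; the local
    comparison transfers this around each parameter. *)
Lemma geodesic_is_arc g a b : is_geodesic rho g a b -> is_arc g a b.
Proof.
have [xx sym tri] := rho_dist; move=> [ab gE]; split; last first.
  move=> s t sab tab gst; apply/eqP; rewrite -subr_eq0 -normr_eq0.
  by rewrite -gE// gst xx.
split=> //; apply/within_continuous_mdist => t tab e e0.
have De : 0 < 2 * D (g t) by rewrite mulr_gt0.
exists (Num.min 2^-1 (e / (2 * D (g t)))).
  by rewrite lt_min invr_gt0 ltr0n divr_gt0.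
move=> u uab; rewrite lt_min ltr_pdivlMr// => /andP[tu1 tu2].
have gtu : rho (g t) (g u) = `|t - u| by apply: gE.
have := rho_loc (x := g t) (y := g u); rewrite gtu => /(_ tu1); lra.
Qed.

(** The factor 2 lets a supremum replace an attained maximum; [exp_lipschitz] makes this supremum
    finite. *)
Lemma geodesic_max g a b : is_geodesic rho g a b ->
  exists2 m, a <= m <= b & forall u, a <= u <= b -> D (g u) <= 2 * D (g m).
Proof.
move=> gG; have ab := gG.1; pose E := [set D (g u) | u in [set u | a <= u <= b]].
have supE : has_sup E.
  split; first by exists (D (g a)), a; rewrite //= lexx.
  exists (expR (2 * (b - a)) * D (g a)) => _ [u /= /andP[au ub] <-].
  apply: le_trans (D_lip (g a) _) _; rewrite ler_pM2r// ler_expR.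
  by rewrite (geodesic_dist gG)//; lra.
have le_sup u : a <= u <= b -> D (g u) <= sup E.
  by move=> uab; apply: ub_le_sup; [exact: supE.2|exists u].
have sup2 : 0 < sup E / 2.
  by rewrite divr_gt0// (lt_le_trans (D0 (g a)))// le_sup// lexx.
have [_ [m mab <-] mE] := sup_adherent sup2 supE.
by exists m => // u /le_sup; lra.
Qed.

Lemma geodesic_decay_length g a b c K t : 0 < c -> 0 < K -> is_geodesic rho g a b ->
  t <= b ->
  (forall s, a <= s -> s <= t -> D (g s) * expR (c * (t - s)) <= K * D (g t)) ->
  exists F : R -> R,
    (forall u v, a <= u -> u <= v -> v <= t -> mdist (g u) (g v) <= F v - F u) /\
    F t - F a <= 2 * K / c * D (g t).
Proof.
move=> c0 K0 gG tb decay.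
exists (fun v => 2 * K / c * D (g t) * expR (c * (v - t))); split.
  by move=> u v au uv vt; exact: (geodesic_increment D0 rho_loc c0 K0 gG tb decay).
rewrite subrr mulr0 expR0 mulr1 gerBl.
by rewrite mulr_ge0 ?expR_ge0// mulr_ge0 ?(ltW (D0 _))//
  divr_ge0 ?mulr_ge0 ?(ltW K0) ?(ltW c0).
Qed.

Lemma geodesic_double_length g a b c K t : 0 < c -> 0 < K -> is_geodesic rho g a b ->
  (forall h a b s t m, is_geodesic rho h a b ->
      a <= s -> s <= t -> t <= m -> m <= b ->
      (forall u, a <= u <= b -> D (h u) <= 2 * D (h m)) ->
      D (h s) * expR (c * (t - s)) <= K * D (h t)) ->
  a <= t <= b ->
  (curve_length g a t <= (2 * K / c * D (g t))%:E)%E \/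
  (curve_length g t b <= (2 * K / c * D (g t))%:E)%E.
Proof.
move=> c0 K0 gG decay /andP[at_ tb].
have [m /andP[am mb] mmax] := geodesic_max gG.
have [tm|/ltW mt] := leP t m; [left|right].
  have [|F [FP Fta]] := geodesic_decay_length c0 K0 gG tb.
    by move=> s as_ st; exact: decay gG as_ st tm mb mmax.
  by apply: le_trans (curve_length_le_increment FP) _; rewrite lee_fin.
(* Beyond the nearly maximal point the geodesic is reversed, and the increment function [F] becomes
   [- F (- s)]. *)
have gG' := is_geodesicN gG.
have [||F [FP Fta]] := geodesic_decay_length (t := - t) c0 K0 gG'.
- by rewrite lerN2.
- move=> s bs st; apply: (decay _ _ _ _ _ (- m) gG') => //; rewrite ?lerN2//.
  by move=> u uab; rewrite /= opprK; apply: mmax; lra.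
apply: le_trans (@curve_length_le_increment _ _ g (fun s => - F (- s)) t b _) _.
  move=> u v tu uv vb; rewrite metric_sym opprK addrC.
  by have := FP (- v) (- u); rewrite /= !opprK; apply; rewrite lerN2.
by rewrite lee_fin opprK addrC; move: Fta; rewrite /= opprK.
Qed.

End geodesics.

Theorem theorem1p3 (R : realType) :
  (forall a delta : R, 1 <= a -> 0 <= delta ->
     exists2 M : R, 1 <= M &
       forall (X : metricType R) (Xbar : completion X),
         minimally_nice X -> john_with Xbar a ->
         gromov_hyperbolic_with Xbar delta ->
         qh_john_with Xbar M) /\
  (forall (X : metricType R) (Xbar : completion X),
     minimally_nice X -> john Xbar -> gromov_hyperbolic Xbar ->
     qh_john Xbar).
Proof.
suff quantitative : forall a delta : R, 1 <= a -> 0 <= delta ->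
     exists2 M : R, 1 <= M &
       forall (X : metricType R) (Xbar : completion X),
         minimally_nice X -> john_with Xbar a ->
         gromov_hyperbolic_with Xbar delta -> qh_john_with Xbar M.
  split=> // X Xbar nice [a a1 ja] [delta delta0 hd].
  by have [M M1 MP] := quantitative a delta a1 delta0; exists M => //; exact: MP.
move=> a delta a1 delta0.
(* These are the growth rate and the comparison constant of the chains extracted from [a]-cone
   arcs. *)
pose c := ln (1 + (2 * a + 1)^-1); pose K := 2 * (2 * a + 1).
have A0 : 0 < 2 * a + 1 by lra.
have c0 : 0 < c by rewrite ln_gt0// ltrDl invr_gt0.
have K0 : 0 < K by rewrite mulr_gt0.
have [K1 K10 track] := cone_chain_tracking delta0 c0 K0.
have [K2 K20 decay] := geodesic_decay c0 K10.
(* [2 * K2 / c] bounds the length of the shorter side in units of [D]. It is fixed before the space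
   is introduced, hence depends on [a] and [delta] alone. *)
exists (Num.max 1 (2 * K2 / c)); first by rewrite le_max lexx.
move=> X Xbar [lc ncX rect_conn _] john hyp.
have bd0 := metric_boundary_nonempty Xbar ncX.
have D0 := dist_boundary_gt0 bd0 lc.
have D_lip := dist_boundary_lip bd0.
have k_dist := qh_distance_function D0 D_lip rect_conn hyp.1.
have k_loc := mdist_le_qh_dist D0 D_lip rect_conn.
have D_exp := local_exp_lipschitz D0 D_lip k_loc hyp.1.
have [kxx ksym ktri] := k_dist.
have chains := john_cone_chains D0 D_lip rect_conn k_dist a1 john.
have trackX := track _ _ _ k_dist hyp D0 D_exp chains.
have decayX := decay _ _ _ D0 D_exp trackX ksym.
move=> g s0 s1 gG; split; first exact: geodesic_is_arc gG.
move=> t; rewrite in_itv/= => tab; rewrite ge_min.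
apply/orP; have le : 2 * K2 / c * dist_boundary Xbar (g t) <=
    Num.max 1 (2 * K2 / c) * dist_boundary Xbar (g t).
  by rewrite ler_pM2r// le_max lexx orbT.
have [h|h] := geodesic_double_length D0 D_exp k_loc c0 K20 gG decayX tab;
  by [left; apply: le_trans h _; rewrite lee_fin|
      right; apply: le_trans h _; rewrite lee_fin].
Qed.
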